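(* Let $X$ be an infinite-dimensional complex Banach space and $T\in L(X)$. If $\sigma_*\in\{\sigma_{\mathcal{W}_+},\sigma_{\mathcal{W}_-},\sigma_{\mathcal{W}},\sigma_{B\mathcal{W}_-},\sigma_{\Phi_+},\sigma_{\Phi_-},\sigma_{\Phi},\sigma_{RD}^e,\sigma_{ap},\sigma_{su},\sigma_{\mathcal{B}_+},\sigma_{\mathcal{B}_-},\sigma_{\mathcal{B}},\sigma_{RD},\sigma\}$ and $$\sigma_*(T)=\partial\sigma_*(T)=\operatorname{acc}\sigma_*(T),$$ then $$\sigma_{TUD}(T)=\sigma_*(T).$$
   Context: $L(X)$ is the algebra of bounded linear operators on $X$; $N(T)$, $R(T)$ are the null space and range; $\alpha(T)=\dim N(T)$, $\beta(T)=\operatorname{codim}R(T)$; $\mathbb{N}_0=\{0,1,2,\dots\}$; $\inf\emptyset=\infty$; $\partial K$ and $\operatorname{acc}K$ are the boundary and the set of accumulation points of $K\subset\mathbb{C}$. $\sigma(T)$, $\sigma_{ap}(T)$, $\sigma_{su}(T)$ are the spectrum, approximate point spectrum ($T-\lambda I$ not bounded below) and surjective spectrum ($T-\lambda I$ not surjective). Ascent $a(T)=\inf\{n\in\mathbb{N}_0:N(T^n)=N(T^{n+1})\}$; descent $\delta(T)=\inf\{n\in\mathbb{N}_0:R(T^n)=R(T^{n+1})\}$; essential descent $\delta_e(T)=\inf\{n\in\mathbb{N}_0:\dim R(T^n)/R(T^{n+1})<\infty\}$. An operator $S$ on a complex Banach space is upper semi-Fredholm ($\Phi_+$) if $\alpha(S)<\infty$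 and $R(S)$ is closed, lower semi-Fredholm ($\Phi_-$) if $\beta(S)<\infty$, Fredholm ($\Phi$) if both; $\operatorname{ind}(S)=\alpha(S)-\beta(S)$. Upper semi-Weyl ($\mathcal{W}_+$): upper semi-Fredholm with $\operatorname{ind}\le0$; lower semi-Weyl ($\mathcal{W}_-$): lower semi-Fredholm with $\operatorname{ind}\ge0$; Weyl ($\mathcal{W}$): Fredholm with $\operatorname{ind}=0$. Upper semi-Browder ($\mathcal{B}_+$): upper semi-Fredholm with finite ascent; lower semi-Browder ($\mathcal{B}_-$): lower semi-Fredholm with finite descent; Browder ($\mathcal{B}$): both. Right Drazin invertible ($RD$): $\delta(T)<\infty$ and $R(T^{\delta(T)})$ closed. Right essentially Drazin invertible: $\delta_e(T)<\infty$ and $R(T^{\delta_e(T)})$ closed (spectrum $\sigma_{RD}^e$). Let $T_n$ be the restriction of $T$ to $R(T^n)$ as a map $R(T^n)\to R(T^n)$; $T$ is lower semi-B-Weyl ($B\mathcal{W}_-$) if for some $n\in\mathbb{N}_0$, $R(T^n)$ is closed, $T_n$ is lower semi-Fredholm and $\operatorname{ind}(T_n)\ge0$ (the index is independent of such $n$). For each class $\mathcal{C}$, $\sigma_{\mathcal{C}}(T)$ is the set of $\lambda\in\mathbb{C}$ such that $T-\lambda I$ is not in the class. Let $k_n(T)=\dim (R(T^n)\cap N(T))/(R(T^{n+1})\cap N(T))$. $T$ has topological uniform descent (TUD) if there is $d\in\mathbb{N}_0$ with $k_n(T)=0$ for all $n\ge d$ and, for all $n\ge d$, $R(T^n)$ closed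 in $R(T^d)$ with respect to the norm $\|y\|_d=\inf\{\|x\|:x\in X,\ y=T^dx\}$; $\sigma_{TUD}(T)$ is the set of $\lambda$ such that $T-\lambda I$ does not have TUD. *)

(* Defs.v *)
From mathcomp Require Import all_boot all_order all_algebra.
From mathcomp Require Import all_classical all_reals all_analysis.
From mathcomp Require Import complex.

Set Implicit Arguments.
Unset Strict Implicit.
Unset Printing Implicit Defensive.

Import Order.TTheory GRing.Theory Num.Theory numFieldNormedType.Exports.

Local Open Scope classical_set_scope.
Local Open Scope ring_scope.
Local Open Scope complex_scope.

Definition boundary (Y : topologicalType) (K : set Y) : set Y :=
  closure K `\` interior K.

Section dimension.
Variables (R : realType) (X : lmodType R[i]).
Implicit Types (U V M : set X) (S : X -> X).

Definition independent_mod V (n : nat) (x : 'I_n -> X) : Prop :=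
  forall c : 'I_n -> R[i], V (\sum_(i < n) c i *: x i) -> forall i, c i = 0.

(* The dimension of U / V for linear subspaces V `<=` U, all infinite dimensions
   being identified with +oo. *)
Definition qdim U V : \bar R :=
  ereal_sup [set n%:R%:E | n in [set n : nat |
    exists x : 'I_n -> X, (forall i, U (x i)) /\ independent_mod V x]].

Definition ldim U : \bar R := qdim U [set 0].

Definition null_space S : set X := [set x | S x = 0].

(* For an S-invariant subspace M, the functions with suffix _on describe the
   restriction of S to a map M -> M; M = setT gives S itself. *)
Definition nullity_on M S : \bar R := ldim (M `&` null_space S).
Definition defect_on M S : \bar R := qdim M (S @` M).

(* Only meaningful when one of the two terms is finite; in particular
   +oo - +oo is -oo in \bar R. *)
Definition fredholm_index_on M S : \bar R := (nullity_on M S - defect_on M S)%E.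

Definition nullity S := nullity_on setT S.
Definition defect S := defect_on setT S.
Definition fredholm_index S := fredholm_index_on setT S.

Definition inf_nat (P : set nat) : \bar R := ereal_inf [set n%:R%:E | n in P].

Definition ascent S : \bar R :=
  inf_nat [set n | null_space (iter n S) = null_space (iter n.+1 S)].

Definition descent S : \bar R :=
  inf_nat [set n | range (iter n S) = range (iter n.+1 S)].

Definition ess_descent S : \bar R :=
  inf_nat [set n | (qdim (range (iter n S)) (range (iter n.+1 S)) < +oo)%E].

End dimension.

Section classes.
Variables (R : realType) (X : completeNormedModType R[i]).
Implicit Types (S : X -> X).

Definition upper_semi_Fredholm S := (nullity S < +oo)%E /\ closed (range S).
Definition lower_semi_Fredholm S : Prop := (defect S < +oo)%E.
Definition Fredholm S := upper_semi_Fredholm S /\ lower_semi_Fredholm S.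

Definition upper_semi_Weyl S := upper_semi_Fredholm S /\ (fredholm_index S <= 0)%E.
Definition lower_semi_Weyl S := lower_semi_Fredholm S /\ (0 <= fredholm_index S)%E.
Definition Weyl S := Fredholm S /\ fredholm_index S = 0%E.

Definition upper_semi_Browder S := upper_semi_Fredholm S /\ (ascent S < +oo)%E.
Definition lower_semi_Browder S := lower_semi_Fredholm S /\ (descent S < +oo)%E.
Definition Browder S := upper_semi_Browder S /\ lower_semi_Browder S.

Definition right_Drazin S :=
  exists2 n : nat, descent S = n%:R%:E & closed (range (iter n S)).
Definition right_ess_Drazin S :=
  exists2 n : nat, ess_descent S = n%:R%:E & closed (range (iter n S)).

Definition lower_semi_B_Weyl S := exists n : nat,
  let M := range (iter n S) in
  [/\ closed M, (defect_on M S < +oo)%E & (0 <= fredholm_index_on M S)%E].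

Definition bounded_below S :=
  exists2 c : R[i], 0 < c & forall x, c * `|x| <= `|S x|.

Definition surjective_op S := range S = setT.

Definition invertible_op S := exists S' : {linear X -> X},
  [/\ continuous S', cancel S S' & cancel S' S].

Definition range_defect (n : nat) S : \bar R :=
  qdim (range (iter n S) `&` null_space S) (range (iter n.+1 S) `&` null_space S).

(* The norm of X takes its (real) values in R[i], hence the real part. *)
Definition range_norm (d : nat) S (y : X) : R :=
  inf [set complex.Re `|x| | x in [set x | y = iter d S x]].

(* A is closed in R(S^d) for the norm range_norm d S. *)
Definition range_norm_closed (d : nat) S (A : set X) :=
  forall y, range (iter d S) y ->
    (forall e : R, 0 < e -> exists2 z, A z & range_norm d S (y - z) < e) -> A y.

Definition TUD S := exists d : nat, forall n : nat, (d <= n)%N ->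
  range_defect n S = 0%E /\ range_norm_closed d S (range (iter n S)).

(* R[i]^o is R[i] with the topology given by the modulus. *)
Definition spectrum_of (C : (X -> X) -> Prop) (T : X -> X) : set R[i]^o :=
  [set l | ~ C (fun x => T x - l *: x)].

End classes.

(* Main.v *)
Require Import Defs.
From HB Require Import structures.
From mathcomp Require Import all_boot all_order all_algebra.
From mathcomp Require Import all_classical all_reals all_analysis.
From mathcomp Require Import complex ring lra.
Import Order.TTheory GRing.Theory Num.Theory numFieldNormedType.Exports.
Local Open Scope classical_set_scope.
Local Open Scope ring_scope.
Local Open Scope complex_scope.

Set Implicit Arguments.
Unset Strict Implicit.
Unset Printing Implicit Defensive.

(** Let [S] be [T - l] for a point [l] of the spectrum in question, and suppose that
    [S] has topological uniform descent from [d] on. Then, for all [m] near but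
    different from 0, the operators [S - m] are Kato operators with one common
    nullity and one common defect ([punctured_neighbourhood]), and on Kato
    operators each of the classes is a condition on these two quantities alone
    ([dim_condition]). Hence a punctured disc around [l] lies inside the spectrum
    or outside of it. If [l] is an accumulation point of the spectrum the disc lies
    inside, so [l] is an interior point, which a boundary point is not
    ([spectrum_TUD]).

    The punctured neighbourhood theorem is proved without quotient spaces and
    without duality. Let [N] be the kernel of [S ^ d]. Uniform descent says that
    the operator induced by [S] on X / N is a Kato operator: it has closed ranges
    and a kernel contained in all of them ([TUD_kato_mod]). Let [Z] be the
    intersection of the sets R(S^n) + N. Up to [N], [S] maps [Z] onto itself, and
    [S] is bounded below modulo [Z]. Both properties survive small perturbations
    and together bound the solutions of the equations (S - m) x = z modulo [N], by
    one constant for all small [m] ([shift_solve]). Kernels and ranges modulo [N]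
    are thus close to each other when the parameters are, and close subspaces have
    the same dimension and codimension, as far as these are compared up to a
    fixed [n] ([gap_dim]); a chain of small steps joins any two parameters
    ([kato_mod_shift]). For [m] other than 0, [S - m] is invertible on [N], so that
    dividing [N] out is harmless.

    Conversely an operator in any of the classes has topological uniform descent.
    Either its kernel is finite dimensional and its range closed
    ([upper_semi_Fredholm_TUD]), or for some [n] the range R(S^n) is closed and
    R(S^n.+1) has finite codimension in it ([TUD_of_finite_descent_step]). In both
    cases R(S^m) is closed for all large [m], and the intersections of R(S^m) and
    N(S) decrease only finitely often because a dimension is finite. *)

(** * Deciding identities in abelian groups *)

(** Formal integer combinations of atoms: two of them have the same value as soon
    as their coefficients agree. *)
Inductive zterm := ZAtom of nat | ZZero | ZAdd of zterm & zterm | ZOpp of zterm.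

Section zterm_eval.
Variables (V : zmodType) (e : seq V).

Fixpoint zeval (t : zterm) : V :=
  match t with
  | ZAtom i => nth 0 e i
  | ZZero => 0
  | ZAdd t1 t2 => zeval t1 + zeval t2
  | ZOpp t1 => - zeval t1
  end.

Fixpoint zcoef (t : zterm) (i : nat) : int :=
  match t with
  | ZAtom j => (i == j)%:Z
  | ZZero => 0
  | ZAdd t1 t2 => zcoef t1 i + zcoef t2 i
  | ZOpp t1 => - zcoef t1 i
  end.

Lemma zevalE t : zeval t = \sum_(i < size e) nth 0 e i *~ zcoef t i.
Proof.
elim: t => [j||t1 IH1 t2 IH2|t IH] /=.
- have [je|ej] := ltnP j (size e); last first.
    rewrite nth_default// big1// => i _.
    by rewrite ltn_eqF ?mulr0z// (leq_trans _ ej).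
  rewrite (bigD1 (Ordinal je))//= eqxx mulr1z big1 ?addr0// => i ij.
  by rewrite (negPf (_ : (i != j :> nat))) ?mulr0z.
- by rewrite big1.
- by rewrite IH1 IH2 -big_split; apply: eq_bigr => i _; rewrite mulrzDr.
- by rewrite IH -sumrN; apply: eq_bigr => i _; rewrite mulrNz.
Qed.

Lemma zeval_eq t1 t2 :
  all (fun i => zcoef t1 i == zcoef t2 i) (iota 0 (size e)) ->
  zeval t1 = zeval t2.
Proof.
move=> /allP h; rewrite !zevalE; apply: eq_bigr => i _.
by rewrite (eqP (h i _))// mem_iota leq0n add0n ltn_ord.
Qed.

End zterm_eval.

(* Atoms are compared up to conversion, since the same term may occur with
   different but convertible structure instances. *)
Ltac zindex x e :=
  lazymatch e with
  | ?y :: ?e' =>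
    match tt with
    | _ => let _ := match tt with _ => unify x y end in constr:(0%N)
    | _ => let n := zindex x e' in constr:(S n)
    end
  end.

Ltac zatoms t e :=
  lazymatch t with
  | 0 => e
  | ?a + ?b => let e1 := zatoms a e in zatoms b e1
  | - ?a => zatoms a e
  | _ => match tt with
         | _ => let n := zindex t e in e
         | _ => constr:(t :: e)
         end
  end.

Ltac zreify t e :=
  lazymatch t with
  | 0 => constr:(ZZero)
  | ?a + ?b => let a' := zreify a e in let b' := zreify b e in constr:(ZAdd a' b')
  | - ?a => let a' := zreify a e in constr:(ZOpp a')
  | _ => let n := zindex t e in constr:(ZAtom n)
  end.

Ltac zmod_eq :=
  lazymatch goal with
  | |- @eq ?V ?a ?b =>
    let e1 := zatoms a (@nil V) in
    let e := zatoms b e1 in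
    let a' := zreify a e in
    let b' := zreify b e in
    apply: (@zeval_eq _ e a' b'); vm_compute; reflexivity
  end.

(** * Real-valued norms *)

Section real_norm.
Variables (R : realType).

(** Norms have values in [R[i]], which is only partially ordered; the estimates are
    carried out on their real parts. *)
Definition nrm (V : normedZmodType R[i]) (x : V) : R := complex.Re `|x|.

Section zmod.
Variable V : normedZmodType R[i].
Implicit Types x y : V.

Lemma nrmE x : `|x| = (nrm x)%:C.
Proof.
rewrite /nrm; have : 0 <= `|x| by [].
by case: `|x| => a b; rewrite lecE /= => /andP[/eqP -> _].
Qed.

Lemma nrm_ge0 x : 0 <= nrm x.
Proof. by rewrite -lecR -nrmE; exact: normr_ge0. Qed.

Lemma nrm0 : nrm (0 : V) = 0.
Proof. by rewrite /nrm normr0. Qed.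

Lemma nrm0_eq0 x : nrm x = 0 -> x = 0.
Proof. by move=> h; apply/normr0_eq0; rewrite nrmE h. Qed.

Lemma nrmN x : nrm (- x) = nrm x.
Proof. by rewrite /nrm normrN. Qed.

Lemma nrmB x y : nrm (x - y) = nrm (y - x).
Proof. by rewrite -nrmN opprB. Qed.

Lemma nrmD x y : nrm (x + y) <= nrm x + nrm y.
Proof. by rewrite -lecR rmorphD /= -!nrmE ler_normD. Qed.

Lemma nrm_sum (I : Type) (r : seq I) (P : pred I) (F : I -> V) :
  nrm (\sum_(i <- r | P i) F i) <= \sum_(i <- r | P i) nrm (F i).
Proof.
apply: (big_ind2 (fun a b => nrm a <= b)) => [|a b c d h1 h2|//].
  by rewrite nrm0.
exact: le_trans (nrmD _ _) (lerD h1 h2).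
Qed.

Lemma nrm_gt0 x : x != 0 -> 0 < nrm x.
Proof.
by move=> x0; rewrite lt_neqAle nrm_ge0 andbT eq_sym; apply: contra_neq x0 => /nrm0_eq0.
Qed.

End zmod.

Lemma nrmM (a b : R[i]) : nrm (a * b) = nrm a * nrm b.
Proof. by rewrite /nrm normrM !nrmE -rmorphM /=. Qed.

Lemma nrmV (a : R[i]) : nrm a^-1 = (nrm a)^-1.
Proof. by rewrite /nrm normfV nrmE -fmorphV /=. Qed.

Lemma nrmR (a : R) : nrm (a%:C) = `|a|.
Proof. by rewrite /nrm normc_def /= expr0n addr0 sqrtr_sqr. Qed.

Lemma nrm_leReIm (a : R[i]) : nrm a <= `|complex.Re a| + `|complex.Im a|.
Proof.
case: a => a b.
have e : Complex a b = a%:C + Complex 0 1 * b%:C :> R[i].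
  by apply/eqP; rewrite eq_complex /=; apply/andP; split; apply/eqP; ring.
rewrite {1}e; apply: le_trans (nrmD _ _) _; rewrite nrmM !nrmR.
have -> : nrm (Complex 0 1 : R[i]) = 1.
  by rewrite /nrm normc_def /= expr0n expr1n add0r sqrtr1.
by rewrite mul1r.
Qed.

Lemma nrmZ (V : normedModType R[i]) (a : R[i]) (x : V) :
  nrm (a *: x) = nrm a * nrm x.
Proof. by rewrite /nrm normrZ !nrmE -rmorphM /=. Qed.

End real_norm.

Section limits.
Variables (R : realType).

Lemma ball_nrm (V : normedModType R[i]) (x y : V) (e : R) :
  ball x e%:C y <-> nrm (x - y) < e.
Proof. by rewrite -ball_normE /= nrmE ltcR. Qed.

Lemma nbhs_nrm (V : normedModType R[i]) (x : V) (A : set V) :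
  nbhs x A <-> exists2 e : R, 0 < e & forall y, nrm (x - y) < e -> A y.
Proof.
split=> [/nbhs_ballP[e /= e0 h]|[e e0 h]].
  have ee : e = (complex.Re e)%:C.
    by move: e0; case: (e) => a b; rewrite ltcE /= => /andP[/eqP -> _].
  exists (complex.Re e); first by rewrite -ltcR -ee.
  by move=> y /ball_nrm; rewrite -ee => /h.
apply/nbhs_ballP; exists e%:C; first by rewrite /= ltcR.
by move=> y /ball_nrm/h.
Qed.

Lemma closed_nrm (V : normedModType R[i]) (A : set V) : closed A <->
  forall x, (forall e : R, 0 < e -> exists2 y, A y & nrm (x - y) < e) -> A x.
Proof.
split=> [cA x h|h x clx].
  by apply: cA => B /nbhs_nrm[e e0 eB]; have [y Ay /eB By] := h _ e0; exists y.
apply: h => e e0.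
have [|y [Ay hy]] := clx [set y | nrm (x - y) < e]; last by exists y.
by apply/nbhs_nrm; exists e.
Qed.

Definition half (n : nat) : R := (2^-1) ^+ n.

Lemma half0 : half 0 = 1. Proof. by rewrite /half expr0. Qed.

Lemma halfS n : half n.+1 = half n / 2. Proof. by rewrite /half exprSr. Qed.

Lemma half_gt0 n : 0 < half n. Proof. by rewrite exprn_gt0. Qed.

Lemma half_le m n : (m <= n)%N -> half n <= half m.
Proof.
by move=> mn; rewrite /half ler_wiXn2l ?invf_le1 ?ler1n// invr_ge0.
Qed.

Lemma half_small (e : R) : 0 < e -> exists n, half n < e.
Proof.
move=> e0; exists (Num.truncn e^-1).+1.
rewrite /half exprVn -[ltRHS]invrK ltf_pV2 ?posrE ?invr_gt0 ?exprn_gt0//.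
apply: lt_trans (truncnS_gt _) _.
by rewrite -natrX ltr_nat ltn_expl.
Qed.

Lemma half_small_mul (c e : R) : 0 < e -> exists n, c * half n < e.
Proof.
move=> e0; have [c0|c0] := ltP 0 c.
  have [n hn] := half_small (divr_gt0 e0 c0).
  by exists n; rewrite mulrC -ltr_pdivlMr.
by exists 0%N; rewrite half0 mulr1; exact: le_lt_trans c0 e0.
Qed.

Lemma nrm_half_tail (V : normedZmodType R[i]) (u : nat -> V) (c : R) :
  (forall k, nrm (u k.+1 - u k) <= c * half k) ->
  forall k m, (k <= m)%N -> nrm (u m - u k) <= 2 * c * (half k - half m).
Proof.
move=> h k m /subnK <-; elim: (m - k)%N => [|j IH].
  by rewrite add0n !subrr nrm0 mulr0.
rewrite addSn -[u (j + k).+1](subrK (u (j + k)%N)) -addrA.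
apply: le_trans (nrmD _ _) _; have := h (j + k)%N; rewrite halfS; lra.
Qed.

Lemma complete_nrm (X : completeNormedModType R[i]) (u : nat -> X) (c : R) :
  (forall k, nrm (u k.+1 - u k) <= c * half k) ->
  exists l, forall k, nrm (l - u k) <= 2 * c * half k.
Proof.
move=> h; have c0 : 0 <= c.
  by have := h 0%N; rewrite half0 mulr1; apply: le_trans; exact: nrm_ge0.
have tl k m : (k <= m)%N -> nrm (u m - u k) <= 2 * c * half k.
  move=> /(nrm_half_tail h)/le_trans; apply.
  by rewrite ler_wpM2l ?mulr_ge0//; have := half_gt0 m; lra.
have : cvg (u @ \oo).
  apply: cauchy_cvg; apply: cauchy_exP => e e0.
  have ee : e = (complex.Re e)%:C.
    by move: e0; case: (e) => a b; rewrite ltcE /= => /andP[/eqP -> _].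
  have e0' : 0 < complex.Re e by rewrite -ltcR -ee.
  have [n hn] := half_small_mul (2 * c) e0'.
  exists (u n); exists n => //= m /= nm.
  by rewrite ee; apply/ball_nrm; rewrite nrmB; exact: le_lt_trans (tl _ _ nm) hn.
rewrite cvg_ex => -[l ul]; exists l => k.
apply/ler_addgt0Pr => e e0.
have : nbhs l [set y | nrm (l - y) < e] by apply/nbhs_nrm; exists e.
move=> /ul[N _ hN].
have /= h1 := hN (maxn N k) (leq_maxl _ _).
have h2 := tl k (maxn N k) (leq_maxr _ _).
rewrite -[l](subrK (u (maxn N k))) -addrA.
apply: le_trans (nrmD _ _) _; lra.
Qed.

Lemma complete_real (u : nat -> R) (c : R) :
  (forall k, `|u k.+1 - u k| <= c * half k) ->
  exists l, forall k, `|l - u k| <= 2 * c * half k.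
Proof.
move=> h.
have tl k m : (k <= m)%N -> `|u m - u k| <= 2 * c * (half k - half m).
  move=> /subnK <-; elim: (m - k)%N => [|j IH].
    by rewrite add0n !subrr normr0 mulr0.
  rewrite addSn -[u (j + k).+1](subrK (u (j + k)%N)) -addrA.
  apply: le_trans (ler_normD _ _) _; have := h (j + k)%N; rewrite halfS; lra.
have c0 : 0 <= c.
  by have := h 0%N; rewrite half0 mulr1; apply: le_trans.
have key k m : u m - 2 * c * half m <= u k + 2 * c * half k.
  have hm := mulr_ge0 c0 (ltW (half_gt0 m)).
  have hk := mulr_ge0 c0 (ltW (half_gt0 k)).
  have [km|/ltnW mk] := leqP k m.
    by have := tl _ _ km; rewrite ler_norml => /andP[]; lra.
  by have := tl _ _ mk; rewrite ler_norml => /andP[]; lra.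
pose A := [set u m - 2 * c * half m | m in [set: nat]].
have ubA k : ubound A (u k + 2 * c * half k) by move=> _ [m _ <-].
exists (sup A) => k; rewrite ler_norml; apply/andP; split.
  have : u k - 2 * c * half k <= sup A.
    by apply: ub_le_sup; [exists (u 0%N + 2 * c * half 0) | exists k].
  lra.
have : sup A <= u k + 2 * c * half k.
  by apply: ge_sup => //; exists (u 0%N - 2 * c * half 0), 0%N.
lra.
Qed.

(** The constant doubles that of [complete_real], as both coordinates contribute
    to the error. *)
Lemma complete_complex (u : nat -> R[i]) (c : R) :
  (forall k, nrm (u k.+1 - u k) <= c * half k) ->
  exists l, forall k, nrm (l - u k) <= 4 * c * half k.
Proof.
move=> h.
have hRe (z : R[i]) : `|complex.Re z| <= nrm z.
  by rewrite -lecR -nrmE normc_ge_Re.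
have hIm (z : R[i]) : `|complex.Im z| <= nrm z.
  case: z => a b /=; rewrite /nrm normc_def /=.
  by rewrite -sqrtr_sqr ler_wsqrtr// lerDr sqr_ge0.
have [a ha] : exists l, forall k, `|l - complex.Re (u k)| <= 2 * c * half k.
  by apply: complete_real => k; rewrite -raddfB; exact: le_trans (hRe _) (h k).
have [b hb] : exists l, forall k, `|l - complex.Im (u k)| <= 2 * c * half k.
  by apply: complete_real => k; rewrite -raddfB; exact: le_trans (hIm _) (h k).
exists (Complex a b) => k; apply: le_trans (nrm_leReIm _) _.
by move: (ha k) (hb k); case: (u k) => x y /=; lra.
Qed.

End limits.

(** * Subspaces and relative dimension *)

Section subspaces.
Variables (R : realType) (X : lmodType R[i]).
Implicit Types (U V W : set X).

Definition is_subspace V :=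
  V 0 /\ forall (a : R[i]) x y, V x -> V y -> V (a *: x + y).

Definition addset U V : set X :=
  [set z | exists x y, [/\ U x, V y & z = x + y]].

Definition span n (x : 'I_n -> X) : set X :=
  [set z | exists c : 'I_n -> R[i], z = \sum_(i < n) c i *: x i].

Section closure_properties.
Variable V : set X.
Hypothesis sV : is_subspace V.

Lemma sub0 : V 0. Proof. by case: sV. Qed.

Lemma subD x y : V x -> V y -> V (x + y).
Proof. by move=> Vx Vy; rewrite -[x]scale1r; exact: sV.2. Qed.

Lemma subZ a x : V x -> V (a *: x).
Proof. by move=> Vx; rewrite -[_ *: _]addr0; apply: sV.2 => //; exact: sub0. Qed.

Lemma subN x : V x -> V (- x).
Proof. by rewrite -scaleN1r; exact: subZ. Qed.

Lemma subB x y : V x -> V y -> V (x - y).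
Proof. by move=> Vx /subN; exact: subD. Qed.

Lemma sub_sum I (r : seq I) (P : pred I) (F : I -> X) :
  (forall i, P i -> V (F i)) -> V (\sum_(i <- r | P i) F i).
Proof. by move=> h; apply: big_ind => //; [exact: sub0|exact: subD]. Qed.

End closure_properties.

Lemma is_subspaceT : is_subspace setT. Proof. by []. Qed.

Lemma is_subspace0 : is_subspace [set 0].
Proof. by split=> //= a x y -> ->; rewrite scaler0 addr0. Qed.

Lemma is_subspaceI U V : is_subspace U -> is_subspace V -> is_subspace (U `&` V).
Proof.
move=> sU sV; split; first by split; exact: sub0.
by move=> a x y [Ux Vx] [Uy Vy]; split; [exact: sU.2|exact: sV.2].
Qed.

Lemma is_subspace_add U V :
  is_subspace U -> is_subspace V -> is_subspace (addset U V).
Proof.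
move=> sU sV; split; first by exists 0, 0; rewrite addr0; split=> //; exact: sub0.
move=> a _ _ [x [y [Ux Vy ->]]] [x' [y' [Ux' Vy' ->]]].
exists (a *: x + x'), (a *: y + y'); split; [exact: sU.2|exact: sV.2|].
by rewrite scalerDr addrACA.
Qed.

Lemma is_subspace_span n (x : 'I_n -> X) : is_subspace (span x).
Proof.
split; first by exists (fun=> 0); rewrite big1// => i _; rewrite scale0r.
move=> a _ _ [c ->] [c' ->]; exists (fun i => a * c i + c' i).
rewrite scaler_sumr -big_split /=; apply: eq_bigr => i _.
by rewrite scalerA scalerDl.
Qed.

Lemma addset_l U V x : is_subspace V -> U x -> addset U V x.
Proof. by move=> sV Ux; exists x, 0; rewrite addr0; split=> //; exact: sub0. Qed.

Lemma addset_r U V x : is_subspace U -> V x -> addset U V x.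
Proof. by move=> sU Ux; exists 0, x; rewrite add0r; split=> //; exact: sub0. Qed.

Definition snoc n (x : 'I_n -> X) (z : X) (i : 'I_n.+1) : X :=
  if unlift ord_max i is Some j then x j else z.

Lemma lift_widen n (j : 'I_n) : lift ord_max j = widen_ord (leqnSn n) j.
Proof. by apply: val_inj; exact: lift_max. Qed.

Lemma snoc_widen n (x : 'I_n -> X) z j : snoc x z (widen_ord (leqnSn n) j) = x j.
Proof. by rewrite /snoc -lift_widen liftK. Qed.

Lemma snoc_max n (x : 'I_n -> X) z : snoc x z ord_max = z.
Proof. by rewrite /snoc unlift_none. Qed.

Lemma ord_max_ind n (P : 'I_n.+1 -> Prop) :
  P ord_max -> (forall j, P (widen_ord (leqnSn n) j)) -> forall i, P i.
Proof.
by move=> h1 h2 i; case: (unliftP ord_max i) => [j ->|-> //]; rewrite lift_widen.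
Qed.

Lemma sum_snoc n (x : 'I_n -> X) z (c : 'I_n.+1 -> R[i]) :
  \sum_(i < n.+1) c i *: snoc x z i =
  \sum_(j < n) c (widen_ord (leqnSn n) j) *: x j + c ord_max *: z.
Proof.
by rewrite big_ord_recr /= snoc_max; under eq_bigr do rewrite snoc_widen.
Qed.

Lemma independent_snoc V n (x : 'I_n -> X) z :
  (forall (c : 'I_n -> R[i]) a, V (\sum_(i < n) c i *: x i + a *: z) ->
     a = 0 /\ forall i, c i = 0) ->
  independent_mod V (snoc x z).
Proof.
move=> h c; rewrite sum_snoc => /h[h1 h2]; exact: ord_max_ind.
Qed.

Lemma independent_head V n (x : 'I_n.+1 -> X) : independent_mod V x ->
  independent_mod V (fun j => x (widen_ord (leqnSn n) j)).
Proof.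
move=> h c Vc.
pose c' (i : 'I_n.+1) := if unlift ord_max i is Some j then c j else 0.
have c'w j : c' (widen_ord (leqnSn n) j) = c j by rewrite /c' -lift_widen liftK.
have c'm : c' ord_max = 0 by rewrite /c' unlift_none.
have /h h0 : V (\sum_(i < n.+1) c' i *: x i).
  rewrite big_ord_recr /= c'm scale0r addr0.
  by under eq_bigr do rewrite c'w.
by move=> i; rewrite -c'w.
Qed.

Lemma independent_last V n (x : 'I_n.+1 -> X) : is_subspace V ->
  independent_mod V x ->
  ~ addset V (span (fun j => x (widen_ord (leqnSn n) j))) (x ord_max).
Proof.
move=> sV ix [v [_ [Vv [c ->] e]]].
pose c' (i : 'I_n.+1) := if unlift ord_max i is Some j then - c j else 1.
have c'w j : c' (widen_ord (leqnSn n) j) = - c j by rewrite /c' -lift_widen liftK.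
have c'm : c' ord_max = 1 by rewrite /c' unlift_none.
suff /ix/(_ ord_max) : V (\sum_(i < n.+1) c' i *: x i).
  by rewrite c'm => /eqP; rewrite oner_eq0.
rewrite big_ord_recr /= c'm scale1r e; under eq_bigr do rewrite c'w scaleNr.
by rewrite sumrN addrCA addNr addr0.
Qed.

(** ** Dimension of a quotient *)

Definition dim_ge U V n := exists x : 'I_n -> X,
  (forall i, U (x i)) /\ independent_mod V x.

Lemma dim_ge0 U V : dim_ge U V 0.
Proof. by exists (fun=> 0); split=> [[]|c _ []]. Qed.

Lemma dim_ge_le U V m n : (m <= n)%N -> dim_ge U V n -> dim_ge U V m.
Proof.
move=> /subnK <-; elim: (n - m)%N => [//|k IH]; rewrite addSn => -[x [Ux ix]].
apply: IH; exists (fun j => x (widen_ord (leqnSn _) j)); split=> //.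
exact: independent_head.
Qed.

Lemma le_qdim U V U' V' :
  (forall n, dim_ge U V n -> dim_ge U' V' n) -> (qdim U V <= qdim U' V')%E.
Proof. by move=> h; apply: le_ereal_sup => _ [n /h dn <-]; exists n. Qed.

Lemma eq_qdim U V U' V' :
  (forall n, dim_ge U V n <-> dim_ge U' V' n) -> qdim U V = qdim U' V'.
Proof.
by move=> h; apply/eqP; rewrite eq_le; apply/andP; split; apply: le_qdim => n /h.
Qed.

Lemma qdim_ltyP U V : (qdim U V < +oo)%E <-> exists n, ~ dim_ge U V n.
Proof.
split=> [h|[n hn]].
  apply: contrapT => /forallNP hn.
  have {}hn n : dim_ge U V n by apply: contrapT; exact: hn.
  have dn n : (n%:R%:E <= qdim U V)%E by apply: ereal_sup_ubound; exists n => //; exact: hn.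
  move: h dn; case: (qdim U V) => [r _ dn|//|_ dn]; last by have := dn 0%N; rewrite leeNy_eq.
  by have := dn (Num.truncn r).+1; rewrite lee_fin leNgt truncnS_gt.
apply: (@le_lt_trans _ _ (n%:R%:E)); last exact: ltry.
apply: ge_ereal_sup => _ [m dm <-]; rewrite lee_fin ler_nat leqNgt.
by apply/negP => /ltnW/dim_ge_le/(_ dm).
Qed.

Lemma qdim_eq0P U V : is_subspace V -> qdim U V = 0%E <-> U `<=` V.
Proof.
move=> sV; split=> [h x Ux|h].
  apply: contrapT => nVx.
  suff : (1%:R%:E <= qdim U V)%E by rewrite h lee_fin ler10.
  apply: ereal_sup_ubound; exists 1%N => //; exists (fun=> x); split=> // c.
  rewrite big_ord1 => Vc i; rewrite (ord1 i); apply/eqP/negPn/negP => c0.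
  by apply: nVx; rewrite -[x](scalerK c0); exact: subZ.
apply/eqP; rewrite eq_le; apply/andP; split; last first.
  by apply: ereal_sup_ubound; exists 0%N => //; exact: dim_ge0.
apply: ge_ereal_sup => _ [[|m] [x [Ux ix]] <-]; first by rewrite lee_fin.
have : V (\sum_i (1 : R[i]) *: x i) by apply: sub_sum => // i _; apply: subZ => //; exact/h/Ux.
by move=> /ix/(_ ord0)/eqP; rewrite oner_eq0.
Qed.

(** A maximal family independent modulo [V] spans a complement. *)
Lemma finite_complement U V : is_subspace U -> is_subspace V -> V `<=` U ->
  (qdim U V < +oo)%E ->
  exists n (x : 'I_n -> X), [/\ forall i, U (x i), independent_mod V x &
    U `<=` addset V (span x)].
Proof.
move=> sU sV VU /qdim_ltyP[N hN].
have [n [dn ndn]] : exists n, dim_ge U V n /\ ~ dim_ge U V n.+1.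
  apply: contrapT => h; apply: hN; elim: N => [|N IH]; first exact: dim_ge0.
  by apply: contrapT => hS; apply: h; exists N.
case: dn => x [Ux ix]; exists n, x; split=> // u Uu.
apply: contrapT => nu; apply: ndn; exists (snoc x u); split.
  by apply: ord_max_ind => [|j]; rewrite ?snoc_max ?snoc_widen.
apply: independent_snoc => c a Vca.
have [a0|a0] := eqVneq a 0.
  by split=> //; apply: ix; move: Vca; rewrite a0 scale0r addr0.
case: nu; exists (a^-1 *: (\sum_i c i *: x i + a *: u)),
  (\sum_i (- (a^-1 * c i)) *: x i); split; [exact: subZ|by eexists|].
rewrite scalerDr scalerK// scaler_sumr addrAC -big_split /=.
rewrite big1 ?add0r// => i _.
by rewrite scalerA -scalerDl subrr scale0r.
Qed.

End subspaces.

(** * Finite extensions of closed subspaces and the gap *)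

Section gap.
Variables (R : realType) (X : completeNormedModType R[i]).
Implicit Types (U V W D : set X) (v d x y z : X).

Lemma dist_pos D v : closed D -> ~ D v ->
  exists2 e : R, 0 < e & forall d, D d -> e <= nrm (v - d).
Proof.
move=> /closed_nrm cD nDv; apply: contrapT => h; apply: nDv; apply: cD => e e0.
apply: contrapT => h'; apply: h; exists e => // d Dd.
by rewrite leNgt; apply/negP => hd; apply: h'; exists d.
Qed.

Lemma dist_scale D v (e : R) (a : R[i]) d : is_subspace D ->
  (forall d, D d -> e <= nrm (v - d)) -> D d -> nrm a * e <= nrm (a *: v - d).
Proof.
move=> sD h Dd; have [->|a0] := eqVneq a 0; first by rewrite nrm0 mul0r nrm_ge0.
have -> : a *: v - d = a *: (v - a^-1 *: d) by rewrite scalerBr scalerKV.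
by rewrite nrmZ ler_wpM2l ?nrm_ge0//; apply: h; exact: subZ.
Qed.

(** When [v] is at positive distance from [D], that distance bounds the coefficient
    of [v], so the coefficients along a convergent sequence converge too. *)
Lemma closed_add_line D v : closed D -> is_subspace D ->
  closed [set z | exists a : R[i], D (z - a *: v)].
Proof.
move=> cD sD; apply/closed_nrm => z hz.
have [Dv|nDv] := pselect (D v).
  exists 0; rewrite scale0r subr0; apply: (closed_nrm D).1 => // e e0.
  have [y [a Da] zy] := hz e e0; exists y => //.
  by rewrite -[y](subrK (a *: v)); apply: subD => //; exact: subZ.
have [e e0 he] := dist_pos cD nDv.
have /choice[f hf] (k : nat) : exists ad : R[i] * X,
    D ad.2 /\ nrm (z - ad.1 *: v - ad.2) < half R k.
  have [y [a Da] zy] := hz _ (half_gt0 R k).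
  exists (a, y - a *: v); split=> //=.
  by rewrite opprB addrA subrK.
pose c := 2 / e.
have [a ha] : exists a, forall k, nrm (a - (f k).1) <= 4 * c * half R k.
  apply: complete_complex => k; rewrite /c mulrAC ler_pdivlMr//.
  have [D1 h1] := hf k; have [D2 h2] := hf k.+1.
  have := dist_scale ((f k.+1).1 - (f k).1) sD he (subB sD D1 D2).
  move=> /le_trans; apply.
  have -> : ((f k.+1).1 - (f k).1) *: v - ((f k).2 - (f k.+1).2) =
    (z - (f k).1 *: v - (f k).2) - (z - (f k.+1).1 *: v - (f k.+1).2).
    by rewrite scalerBl; zmod_eq.
  apply: le_trans (nrmD _ _) _; rewrite nrmN.
  have := half_gt0 R k; rewrite halfS in h2; lra.
exists a; apply: (closed_nrm D).1 => // e' e'0.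
have [k hk] := half_small_mul (1 + 4 * c * nrm v) e'0.
have [D1 h1] := hf k; exists (f k).2 => //; apply: le_lt_trans hk.
have -> : z - a *: v - (f k).2 =
   (z - (f k).1 *: v - (f k).2) - (a - (f k).1) *: v.
  by rewrite scalerBl; zmod_eq.
apply: le_trans (nrmD _ _) _; rewrite nrmN nrmZ mulrDl mul1r.
apply: lerD; first exact: ltW.
by rewrite mulrAC ler_wpM2r ?nrm_ge0.
Qed.

Lemma addset_span_recr D n (x : 'I_n.+1 -> X) :
  addset D (span x) = [set z | exists a : R[i],
    addset D (span (fun j => x (widen_ord (leqnSn n) j))) (z - a *: x ord_max)].
Proof.
apply/seteqP; split=> [z [d [_ [Dd [c ->] ->]]]|z [a [d [_ [Dd [c ->] e]]]]].
  exists (c ord_max), d, (\sum_(j < n) c (widen_ord (leqnSn n) j) *: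
    x (widen_ord (leqnSn n) j)); split=> //; first by eexists.
  by rewrite big_ord_recr /= addrA addrK.
exists d, (\sum_i (snoc (c : _ -> R[i]^o) a) i *: x i); split=> //; first by eexists.
rewrite big_ord_recr /= snoc_max; under eq_bigr do rewrite snoc_widen.
by rewrite addrA -e subrK.
Qed.

Lemma closed_add_span D n (x : 'I_n -> X) : closed D -> is_subspace D ->
  closed (addset D (span x)).
Proof.
move=> cD sD; elim: n x => [|n IH] x.
  suff -> : addset D (span x) = D by [].
  apply/seteqP; split=> [_ [d [_ [Dd [c ->] ->]]]|d Dd].
    by rewrite big_ord0 addr0.
  by apply: addset_l => //; exact: is_subspace_span.
rewrite addset_span_recr; apply: closed_add_line; first exact: IH.
by apply: is_subspace_add => //; exact: is_subspace_span.
Qed.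

(** Riesz's lemma with the constant 1/2: subtract from [v] an almost nearest point
    of [D] and normalise. *)
Lemma riesz D v : closed D -> is_subspace D -> ~ D v ->
  exists (a : R[i]) d, [/\ D d, nrm (a *: (v - d)) <= 1 &
    forall (b : R[i]) d', D d' -> nrm b <= 2 * nrm (b *: (a *: (v - d)) - d')].
Proof.
move=> cD sD nDv; have [e e0 he] := dist_pos cD nDv.
pose A := [set nrm (v - d) | d in D].
have hA : has_inf A.
  by split; [exists (nrm (v - 0)), 0 => //; exact: sub0|exists e => _ [d Dd <-]; exact: he].
have A0 : 0 < inf A.
  apply: lt_le_trans e0 _; apply: lb_le_inf; first exact: hA.1.
  by move=> _ [d Dd <-]; exact: he.
have [_ [d Dd <-]] := inf_adherent A0 hA.
set r := nrm (v - d) => hr.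
have infA d' : D d' -> inf A <= nrm (v - d').
  by move=> Dd'; apply: ge_inf; [exact: hA.2|exists d'].
have r0 : 0 < r by apply: lt_le_trans A0 (infA _ Dd).
have nr : nrm (r^-1%:C) = r^-1 by rewrite nrmR ger0_norm// invr_ge0 ltW.
exists (r^-1)%:C, d; split=> // [|b d' Dd'].
  by rewrite nrmZ nr mulVf// gt_eqF.
have := @dist_scale D (v - d) (inf A) (b * r^-1%:C) d' sD.
rewrite -scalerA nrmM nr => /(_ _ Dd') h.
apply: (@le_trans _ _ (2 * (nrm b / r * inf A))); last first.
  rewrite ler_wpM2l//; apply: h => y Dy.
  by rewrite -addrA -opprD; apply: infA; exact: subD.
have t0 : 0 <= nrm b / r by rewrite divr_ge0 ?nrm_ge0// ltW.
have -> : nrm b = nrm b / r * r by rewrite divfK// gt_eqF.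
rewrite mulfK ?gt_eqF//; nra.
Qed.

(** Each vector is chosen by [riesz] almost orthogonal to [V] and to its
    predecessors. The coefficients are then recovered from the last one down, each
    time at the cost of a factor 3. *)
Lemma quant_basis V n (x : 'I_n -> X) : closed V -> is_subspace V ->
  independent_mod V x ->
  exists y : 'I_n -> X, [/\ forall i, addset V (span x) (y i),
    forall i, nrm (y i) <= 1 &
    forall (c : 'I_n -> R[i]) v, V v ->
      forall i, nrm (c i) <= 2 * 3 ^+ n * nrm (\sum_j c j *: y j - v)].
Proof.
move=> cV sV; elim: n x => [|n IH] x ix; first by exists (fun=> 0); split=> [[]|[]|? ? ? []].
pose x' j := x (widen_ord (leqnSn n) j).
have [y [yW y1 yc]] := IH x' (independent_head ix).
have sW : is_subspace (addset V (span x')).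
  by apply: is_subspace_add => //; exact: is_subspace_span.
have [a [d [Wd az1 azd]]] :=
  riesz (@closed_add_span _ n x' cV sV) sW (independent_last sV ix).
set z := a *: _ in az1 azd.
have WW : addset V (span x') `<=` addset V (span x).
  by move=> w Ww; rewrite addset_span_recr; exists 0; rewrite scale0r subr0.
exists (snoc y z); split.
- apply: ord_max_ind => [|j]; rewrite ?snoc_max ?snoc_widen; last exact: WW.
  rewrite addset_span_recr; exists a.
  have -> : z - a *: x ord_max = - (a *: d) by rewrite /z scalerBr; zmod_eq.
  by apply: subN => //; exact: subZ.
- by apply: ord_max_ind => [|j]; rewrite ?snoc_max ?snoc_widen.
move=> c v Vv; set c' := fun j => c (widen_ord (leqnSn n) j).
rewrite sum_snoc; set s := \sum_(j < n) _; set t := nrm _.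
have t0 : 0 <= t := nrm_ge0 _.
have K1 : 1 <= 3 ^+ n :> R by rewrite exprn_ege1// ler1n.
have cm : nrm (c ord_max) <= 2 * t.
  have -> : t = nrm (c ord_max *: z - (v - s)).
    by congr nrm; zmod_eq.
  apply: azd; apply: subB => //; last by apply: sub_sum => // i _; exact: subZ.
  by apply: addset_l => //; exact: is_subspace_span.
have sv : nrm (s - v) <= 3 * t.
  have -> : s - v = (s + c ord_max *: z - v) - c ord_max *: z.
    by zmod_eq.
  apply: le_trans (nrmD _ _) _; rewrite nrmN nrmZ -/t.
  have := nrm_ge0 z; have := nrm_ge0 (c ord_max); nra.
apply: ord_max_ind => [|j].
  by apply: le_trans cm _; rewrite exprS; nra.
apply: le_trans (yc c' v Vv j) _; rewrite exprS -/s; nra.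
Qed.

(** A linear relation, modulo [V'], between vectors close to those of
    [quant_basis] is a relation between the latter up to an error that their
    coefficient bounds forbid. Since these bounds depend on [n] only, so does the
    admissible distance, which allows [kato_mod_shift] to take steps of constant
    length. *)
Lemma gap_dim n : exists2 e : R, 0 < e & forall U V U' V',
  closed V -> is_subspace V -> is_subspace U -> V `<=` U ->
  (forall u, U u -> exists2 u', U' u' & nrm (u - u') <= e * nrm u) ->
  (forall v', V' v' -> exists2 v, V v & nrm (v - v') <= e * nrm v') ->
  dim_ge U V n -> dim_ge U' V' n.
Proof.
pose K : R := 2 * 3 ^+ n.
have K0 : 2 <= K.
  by rewrite /K -[leLHS]mulr1 ler_wpM2l// exprn_ege1// ler1n.
(* An error of 3 * e * s in the vectors costs at most n * K * (3 * e * s) in the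
   sum s of the moduli of the coefficients; this choice of e makes it s / 2. *)
pose e := (6 * n.+1%:R * K)^-1.
have n0 : 1 <= n.+1%:R :> R by rewrite ler1n.
have D0 : 1 <= 6 * n.+1%:R * K by nra.
have e0 : 0 < e by rewrite invr_gt0; lra.
have e1 : e <= 1 by rewrite invf_le1//; lra.
exists e => // U V U' V' cV sV sU VU hU hV [x [Ux ix]].
have [y [yW y1 yc]] := quant_basis cV sV ix.
have Uy i : U (y i).
  have [v [_ [Vv [c ->] ->]]] := yW i.
  apply: subD => //; first exact: VU.
  by apply: sub_sum => // j _; apply: subZ => //; exact: Ux.
have /choice[y' hy'] i : exists u', U' u' /\ nrm (y i - u') <= e.
  have [u' U'u' h] := hU _ (Uy i); exists u'; split=> //.
  by apply: le_trans h _; rewrite -[leRHS]mulr1 ler_wpM2l// ltW.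
exists y'; split=> [i|c V'c]; first by case: (hy' i).
have [v Vv hv] := hV _ V'c.
set v' := \sum_i _ in V'c hv.
pose s := \sum_i nrm (c i).
have s0 : 0 <= s by apply: sumr_ge0 => i _; exact: nrm_ge0.
have h1 : nrm (\sum_j c j *: y j - v') <= e * s.
  rewrite /v' -sumrB; apply: le_trans (nrm_sum _ _ _) _.
  rewrite mulr_sumr; apply: ler_sum => i _.
  rewrite -scalerBr nrmZ mulrC ler_wpM2r ?nrm_ge0//; exact: (hy' i).2.
have h2 : nrm v' <= 2 * s.
  apply: le_trans (nrm_sum _ _ _) _; rewrite mulr_sumr; apply: ler_sum => i _.
  rewrite nrmZ mulrC ler_wpM2r ?nrm_ge0//.
  rewrite -[y' i](subrK (y i)) addrC -[_ - _]opprB.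
  by apply: le_trans (nrmD _ _) _; rewrite nrmN; have := y1 i; have := (hy' i).2; lra.
have h3 : nrm (\sum_j c j *: y j - v) <= 3 * e * s.
  rewrite -[\sum_j _](subrK v') -addrA; apply: le_trans (nrmD _ _) _.
  by rewrite [nrm (v' - v)]nrmB; nra.
have h4 : s <= n%:R * (K * (3 * e * s)).
  rewrite /s; apply: le_trans (_ : \sum_(i < n) (K * (3 * e * s)) <= _).
    apply: ler_sum => i _; apply: le_trans (yc c v Vv i) _.
    by rewrite -/K ler_wpM2l//; lra.
  by rewrite sumr_const card_ord -[leLHS]mulr_natl.
have h5 : s = 0.
  have eq1 : e * (6 * n.+1%:R * K) = 1 by rewrite mulVf//; lra.
  have : n%:R <= n.+1%:R :> R by rewrite ler_nat.
  move=> hn; apply/eqP; rewrite eq_le s0 andbT.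
  have : n%:R * (K * (3 * e * s)) <= n.+1%:R * (K * (3 * e * s)).
    by apply: ler_wpM2r => //; rewrite !mulr_ge0//; lra.
  have -> : n.+1%:R * (K * (3 * e * s)) = e * (6 * n.+1%:R * K) * s / 2 by field.
  by rewrite eq1; lra.
move=> i; apply: nrm0_eq0; apply/eqP; rewrite eq_le nrm_ge0 andbT -h5 /s.
by rewrite (bigD1 i)//= lerDl sumr_ge0// => j _; exact: nrm_ge0.
Qed.

End gap.

(** * Solving operator equations with bounds *)

Section solving.
Variables (R : realType) (X : completeNormedModType R[i]).
Implicit Types (A : {linear X -> X}) (D N F : set X) (x y z : X).

Definition bounded_by (K : R) (A : X -> X) :=
  0 <= K /\ forall x, nrm (A x) <= K * nrm x.

Lemma continuous_bounded A : continuous A -> exists K, bounded_by K A.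
Proof.
move=> /(_ 0)/(continuous_linear_bounded (0 : X))/linear_boundedP.
move=> /pinfty_ex_gt0[[a b] + hM]; rewrite ltcE /= => /andP[/eqP b0 a0].
exists a; split=> [|x]; first exact: ltW.
have := hM x; rewrite !nrmE b0 -[Complex a 0]/(a%:C) -rmorphM /=.
by rewrite lecR.
Qed.

(** The successive corrections of an approximate solution form a geometric
    series, whose sum is a solution. *)
Lemma solve_of_approx A K D N F (C : R) : bounded_by K A ->
  closed D -> is_subspace D -> closed N -> is_subspace N -> 0 <= C ->
  (forall z, F z -> exists x n, [/\ D x, N n, nrm x <= C * nrm z,
     nrm (z - A x - n) <= nrm z / 2 & F (z - A x - n)]) ->
  forall z, F z -> exists x n, [/\ D x, N n, z = A x + n & nrm x <= 2 * C * nrm z].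
Proof.
move=> [K0 hK] cD sD cN sN C0 h z Fz.
have /choice[g hg] (y : X) : exists p : X * X, F y ->
    [/\ D p.1, N p.2, nrm p.1 <= C * nrm y,
     nrm (y - A p.1 - p.2) <= nrm y / 2 & F (y - A p.1 - p.2)].
  have [Fy|nFy] := pselect (F y); last by exists (0, 0).
  by have [x [n hxn]] := h y Fy; exists (x, n).
(* st k is the pair of the partial sums for x and for n, and res the remainder. *)
pose res (s : X * X) := z - A s.1 - s.2.
pose st k := iter k (fun s => (s.1 + (g (res s)).1, s.2 + (g (res s)).2)) (0, 0).
have stS k : st k.+1 = ((st k).1 + (g (res (st k))).1, (st k).2 + (g (res (st k))).2).
  by [].
have resS k : res (st k.+1) =
    res (st k) - A (g (res (st k))).1 - (g (res (st k))).2.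
  by rewrite {1}/res stS /= linearD /res; zmod_eq.
have inv k : [/\ D (st k).1, N (st k).2, F (res (st k)) &
    nrm (res (st k)) <= nrm z * half R k].
  elim: k => [|k [Du Nv Fr nr]].
    split; [exact: sub0|exact: sub0| |]; rewrite /res /= linear0 !subr0 //.
    by rewrite half0 mulr1.
  have [h1 h2 h3 h4 h5] := hg _ Fr.
  split; rewrite ?resS //= ; [exact: subD|exact: subD|].
  by apply: le_trans h4 _; rewrite halfS; lra.
have [l hl] : exists l, forall k, nrm (l - (st k).1) <= 2 * (C * nrm z) * half R k.
  apply: complete_nrm => k; have [_ _ Fr nr] := inv k.
  have [_ _ h3 _ _] := hg _ Fr; rewrite stS /= addrC addKr.
  by apply: le_trans h3 _; rewrite -mulrA ler_wpM2l.
exists l, (z - A l); split.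
- apply: (closed_nrm D).1 => // e e0.
  have [k hk] := half_small_mul (2 * (C * nrm z)) e0.
  by exists (st k).1; [case: (inv k)|exact: le_lt_trans (hl k) hk].
- apply: (closed_nrm N).1 => // e e0.
  have [k hk] := half_small_mul (nrm z + K * (2 * (C * nrm z))) e0.
  have [_ Nv _ nr] := inv k; exists (st k).2 => //; apply: le_lt_trans hk.
  have -> : z - A l - (st k).2 = res (st k) - A (l - (st k).1).
    by rewrite /res linearB; zmod_eq.
  apply: le_trans (nrmD _ _) _; rewrite nrmN mulrDl; apply: lerD => //.
  by apply: le_trans (hK _) _; rewrite -mulrA ler_wpM2l.
- by rewrite addrC subrK.
- by have := hl 0%N; rewrite /= subr0 half0 mulr1 mulrA.
Qed.

(** With bounded solutions, a limit point of the range is approximated by values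
    with a remainder that is again a limit point, so that [solve_of_approx] applies to the
    closure of the range. *)
Lemma closed_of_solve A K D N (C : R) : bounded_by K A ->
  closed D -> is_subspace D -> closed N -> is_subspace N -> 0 <= C ->
  (forall z, addset (A @` D) N z -> exists x n,
     [/\ D x, N n, z = A x + n & nrm x <= C * nrm z]) ->
  closed (addset (A @` D) N).
Proof.
move=> bA cD sD cN sN C0 h; apply/closed_nrm => z hz.
pose F := [set z | forall e : R, 0 < e ->
  exists2 y, addset (A @` D) N y & nrm (z - y) < e].
have [||x [n [Dx Nn -> _]]] := @solve_of_approx A K D N F (2 * C) bA cD sD cN sN _ _ z hz.
- by rewrite mulr_ge0.
- move=> y Fy; have [->|y0] := eqVneq y 0.
    exists 0, 0; rewrite linear0 !subr0 nrm0 mulr0 mul0r; split=> //; try exact: sub0.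
    move=> e e0; exists 0; last by rewrite subrr nrm0.
    exists 0, 0; split; [exists 0; rewrite ?linear0//; exact: sub0|exact: sub0|].
    by rewrite addr0.
  have ny := nrm_gt0 y0.
  have [w Fw yw] := Fy (nrm y / 2) (divr_gt0 ny (ltr0Sn _ _)).
  have [x [n [Dx Nn e nx]]] := h w Fw.
  have rE : y - A x - n = y - w by rewrite e; zmod_eq.
  exists x, n; rewrite rE; split=> //; last 2 first.
  + exact: ltW.
  + move=> e' e'0; have [w' Fw' yw'] := Fy _ e'0.
    exists (w' - w); last by have -> : y - w - (w' - w) = y - w' by zmod_eq.
    move: Fw Fw' => [_ [m [[u Du <-] Nm ->]]] [_ [m' [[u' Du' <-] Nm' ->]]].
    exists (A (u' - u)), (m' - m); split; [|exact: subB|by rewrite linearB; zmod_eq].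
    by exists (u' - u) => //; exact: subB.
  apply: le_trans nx _; rewrite [2 * C]mulrC -mulrA ler_wpM2l//.
  have -> : w = y - (y - w) by zmod_eq.
  by apply: le_trans (nrmD _ _) _; rewrite nrmN; lra.
by exists (A x), n; split=> //; exists x.
Qed.

(** Baire's theorem inside a closed subset: otherwise nested balls of [F] would
    shrink to a point of [F] that avoids every [E k]. *)
Lemma baire_closed F (E : nat -> set X) : closed F -> F !=set0 ->
  F `<=` \bigcup_k E k ->
  exists k z0 (r : R), [/\ F z0, 0 < r & forall z, F z -> nrm (z - z0) < r ->
    forall e : R, 0 < e -> exists2 y, E k y & nrm (z - y) < e].
Proof.
move=> cF [x0 Fx0] FE; apply: contrapT => hn.
have H (k : nat) (p : X * R) : exists q : X * R, F p.1 /\ 0 < p.2 ->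
    [/\ F q.1, 0 < q.2, q.2 <= p.2 / 2, nrm (q.1 - p.1) <= p.2 / 2 &
        forall y, E k y -> 2 * q.2 <= nrm (q.1 - y)].
  have [[Fp p0]|] := pselect (F p.1 /\ 0 < p.2); last by exists p.
  apply: contrapT => hq; apply: hn; exists k, p.1, (p.2 / 2); split=> //.
    by rewrite divr_gt0.
  move=> z Fz zp e e0; apply: contrapT => hy; apply: hq.
  exists (z, Num.min (e / 2) (p.2 / 2)) => _ /=; split=> //.
  - by rewrite lt_min !divr_gt0.
  - by rewrite ge_min lexx orbT.
  - exact: ltW.
  - move=> y Ey; rewrite leNgt; apply/negP => hh; apply: hy; exists y => //.
    have : Num.min (e / 2) (p.2 / 2) <= e / 2 by rewrite ge_min lexx.
    lra.
have /choice[f hf] : forall kp : nat * (X * R), exists q : X * R,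
    F kp.2.1 /\ 0 < kp.2.2 -> [/\ F q.1, 0 < q.2, q.2 <= kp.2.2 / 2,
      nrm (q.1 - kp.2.1) <= kp.2.2 / 2 &
      forall y, E kp.1 y -> 2 * q.2 <= nrm (q.1 - y)].
  by move=> [k p]; exact: H.
pose fix s k := if k is j.+1 then f (j, s j) else (x0, 1).
have inv k : F (s k).1 /\ 0 < (s k).2.
  by elim: k => [//|k IH] /=; have [] := hf (k, s k) IH.
have st k := hf (k, s k) (inv k).
have rS k : (s k).2 <= half R k.
  elim: k => [|k IH]; first by rewrite half0.
  by have [_ _ h _ _] := st k; rewrite halfS; apply: le_trans h _; rewrite /=; lra.
have [l hl] : exists l, forall k, nrm (l - (s k).1) <= 2 * 1 * half R k.
  apply: complete_nrm => k; have [_ _ _ h _] := st k; apply: le_trans h _ => /=.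
  by have := rS k; have := half_gt0 R k; lra.
have tl k j : nrm ((s (j + k)%N).1 - (s k).1) <= (s k).2 - (s (j + k)%N).2.
  elim: j => [|j IH]; first by rewrite add0n !subrr nrm0.
  have [_ _ h1 h2 _] := st (j + k)%N; rewrite addSn.
  rewrite -[(s (j + k).+1).1](subrK (s (j + k)%N).1) -addrA.
  by apply: le_trans (nrmD _ _) _; move: h1 h2 => /=; lra.
have lk k : nrm (l - (s k).1) <= (s k).2.
  apply/ler_addgt0Pr => e e0; have [m hm] := half_small_mul 2 e0.
  have h1 := hl (m + k)%N; have h2 := tl k m; have [_ h3] := inv (m + k)%N.
  have h4 := half_le R (leq_addr k m).
  rewrite -[l](subrK (s (m + k)%N).1) -addrA.
  by apply: le_trans (nrmD _ _) _; lra.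
have Fl : F l.
  apply: (closed_nrm F).1 => // e e0; have [m hm] := half_small_mul 2 e0.
  by exists (s m).1; [case: (inv m)|have := hl m; lra].
have [j _ El] := FE _ Fl.
have [_ h0 _ _ h] := st j.
by move: (h _ El) (lk j.+1) h0; rewrite nrmB /=; lra.
Qed.

(** By Baire's theorem the values of bounded arguments are dense in some ball of
    the range; differences and multiples of them then approximate every value
    proportionally to its norm. *)
Lemma open_mapping A K D N : bounded_by K A ->
  closed D -> is_subspace D -> closed N -> is_subspace N ->
  closed (addset (A @` D) N) ->
  exists2 C : R, 0 <= C & forall z, addset (A @` D) N z -> exists x n,
     [/\ D x, N n, z = A x + n & nrm x <= C * nrm z].
Proof.
move=> bA cD sD cN sN; set F := addset _ _ => cF.
pose E (k : nat) := [set z | exists x n, [/\ D x, N n, z = A x + n & nrm x <= k%:R]].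
have FP z : F z <-> exists x n, [/\ D x, N n & z = A x + n].
  split=> [[_ [n [[x Dx <-] Nn ->]]]|[x [n [Dx Nn ->]]]]; first by exists x, n.
  by exists (A x), n; split=> //; exists x.
have sF : is_subspace F.
  split; first by apply/FP; exists 0, 0; rewrite linear0 addr0; split=> //; exact: sub0.
  move=> a _ _ /FP[x [n [Dx Nn ->]]] /FP[x' [n' [Dx' Nn' ->]]].
  apply/FP; exists (a *: x + x'), (a *: n + n'); split; [exact: sD.2|exact: sN.2|].
  by rewrite linearP scalerDr; zmod_eq.
have FE : F `<=` \bigcup_k E k.
  move=> _ /FP[x [n [Dx Nn ->]]]; exists (Num.truncn (nrm x)).+1 => //.
  by exists x, n; split=> //; apply/ltW/truncnS_gt.
have [k [z0 [r [Fz0 r0 hr]]]] := baire_closed cF (ex_intro _ 0 (sub0 sF)) FE.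
have near0 z : F z -> nrm z < r -> forall e : R, 0 < e -> exists x n,
    [/\ D x, N n, nrm x <= 2 * k%:R & nrm (z - A x - n) < e].
  move=> Fz zr e e0; have e2 : 0 < e / 2 by rewrite divr_gt0.
  have [||y1 [x1 [n1 [Dx1 Nn1 -> nx1]]] h1] := hr (z + z0) _ _ _ e2.
  - exact: subD.
  - by rewrite addrK.
  have [||y2 [x2 [n2 [Dx2 Nn2 -> nx2]]] h2] := hr z0 _ _ _ e2.
  - by [].
  - by rewrite subrr nrm0.
  exists (x1 - x2), (n1 - n2); split; [exact: subB|exact: subB| |].
    by apply: le_trans (nrmD _ _) _; rewrite nrmN; lra.
  have -> : z - A (x1 - x2) - (n1 - n2) =
      (z + z0 - (A x1 + n1)) - (z0 - (A x2 + n2)).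
    by rewrite linearB; zmod_eq.
  by apply: le_lt_trans (nrmD _ _) _; rewrite nrmN; lra.
pose C := 4 * k%:R / r.
have C0 : 0 <= C by rewrite divr_ge0 ?mulr_ge0// ltW.
exists (2 * C) => [|z Fz]; first by rewrite mulr_ge0.
apply: (@solve_of_approx A K D N F C bA) => // {z Fz} z Fz.
have [->|z0'] := eqVneq z 0.
  exists 0, 0; rewrite linear0 !subr0 nrm0 mulr0 mul0r.
  by split=> //; exact: sub0.
have nz := nrm_gt0 z0'.
pose t := 2 * nrm z / r.
have t0 : 0 < t by rewrite divr_gt0 ?mulr_gt0.
have tr : t * r = 2 * nrm z by rewrite /t divfK// gt_eqF.
have nt : nrm (t%:C) = t by rewrite nrmR gtr0_norm.
have tC : t%:C != 0 by apply/eqP => /(congr1 (@nrm R _)); rewrite nt nrm0; lra.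
have [||x [n [Dx Nn nx h]]] := near0 ((t%:C)^-1 *: z) _ _ (r / 4) (divr_gt0 r0 (ltr0Sn _ _)).
- exact: subZ.
- rewrite nrmZ nrmV nt mulrC ltr_pdivrMr//; nra.
exists (t%:C *: x), (t%:C *: n).
have e : z - A (t%:C *: x) - t%:C *: n = t%:C *: ((t%:C)^-1 *: z - A x - n).
  by rewrite linearZ !scalerBr scalerKV.
split; [exact: subZ|exact: subZ| | |].
- have -> : C * nrm z = t * (2 * k%:R) by rewrite /C /t; field; rewrite gt_eqF.
  by rewrite nrmZ nt ler_pM2l.
- by rewrite e nrmZ nt; nra.
- apply: subB => //; last by apply/FP; exists 0, (t%:C *: n); rewrite linear0 add0r;
    split=> //; [exact: sub0|exact: subZ].
  apply: subB => //; apply/FP; exists (t%:C *: x), 0; rewrite addr0.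
  by split=> //; [exact: subZ|exact: sub0].
Qed.

End solving.

(** * Perturbation of a Kato operator on a quotient *)

Section shifts.
Variables (R : realType) (X : lmodType R[i]).
Implicit Types (S : {linear X -> X}) (m : R[i]).

Definition shift (S : X -> X) (m : R[i]) : X -> X := fun x => S x - m *: x.

Lemma shift_linear S m : linear (shift S m).
Proof.
move=> a x y; rewrite /shift linearP !scalerDr !scalerA [m * a]mulrC scalerN.
by rewrite scalerA; zmod_eq.
Qed.

HB.instance Definition _ S m :=
  GRing.isLinear.Build R[i] X X *:%R (shift S m) (shift_linear S m).

Lemma iter_linear S n : linear (iter n S).
Proof. by elim: n => [//|n IH] a x y; rewrite !iterS IH linearP. Qed.

HB.instance Definition _ S n :=
  GRing.isLinear.Build R[i] X X *:%R (iter n S) (iter_linear S n).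

Lemma shift_add S l m : shift (shift S l) m = shift S (l + m).
Proof. by apply/funext => x; rewrite /shift scalerDl; zmod_eq. Qed.

Lemma is_subspace_range (A : {linear X -> X}) : is_subspace (range A).
Proof.
split; first by exists 0; rewrite ?linear0.
by move=> a _ _ [x _ <-] [y _ <-]; exists (a *: x + y); rewrite ?linearP.
Qed.

Lemma is_subspace_null (A : {linear X -> X}) : is_subspace (null_space A).
Proof.
split=> [|a x y]; rewrite /null_space /= ?linear0// => Ax Ay.
by rewrite linearP Ax Ay scaler0 addr0.
Qed.

Lemma range_iter_le S (m n : nat) : (m <= n)%N -> range (iter n S) `<=` range (iter m S).
Proof.
move=> /subnK <- _ [x _ <-]; exists (iter (n - m) S x) => //.
by rewrite addnC iterD.
Qed.

Lemma eigen_iter S m n x : shift S m x = 0 -> iter n S x = m ^+ n *: x.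
Proof.
move=> /subr0_eq e; elim: n => [|n IH]; first by rewrite scale1r.
by rewrite iterS IH linearZ /= e scalerA exprSr.
Qed.

(** [S] being nilpotent on the kernel of its power, [S - m] is invertible there. *)
Lemma shift_null_onto S m d n : m != 0 -> iter d S n = 0 ->
  exists2 n', iter d S n' = 0 & shift S m n' = n.
Proof.
move=> m0; elim: d n => [|d IH] n; first by move=> /= ->; exists 0; rewrite ?linear0.
rewrite iterSr => /IH[y y0 e]; exists (m^-1 *: (y - n)).
  have := congr1 (iter d S) e; rewrite /shift linearB linearZ /= y0 scaler0 subr0.
  rewrite -!iterSr /= y0 linear0 2!linearZ 2!linearB /= => <-.
  by rewrite y0 linear0 subrr scaler0.
rewrite linearZ linearB /= e /shift opprB addrC subrK.
by rewrite scalerK.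
Qed.

End shifts.

Section kato.
Variables (R : realType) (X : completeNormedModType R[i]).
Implicit Types (S A : {linear X -> X}) (N Z : set X) (x y z w : X) (l m : R[i]).

(** The operators also called semi-regular. *)
Definition kato (A : X -> X) :=
  closed (range A) /\ forall n, null_space A `<=` range (iter n A).

(** The operator that [S] induces on the quotient by [N] has closed ranges and a
    kernel contained in all of them. *)
Definition kato_mod S N :=
  [/\ closed N, is_subspace N, forall x, N x -> N (S x),
      forall n, closed (addset (range (iter n S)) N) &
      forall n x, N (S x) -> addset (range (iter n S)) N x].

Lemma bounded_shift S K l :
  bounded_by K S -> bounded_by (K + nrm l) (shift S l).
Proof.
move=> [K0 hK]; split=> [|x]; first by rewrite addr_ge0 ?nrm_ge0.
apply: le_trans (nrmD _ _) _; rewrite nrmN nrmZ mulrDl.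
by rewrite lerD2r.
Qed.

Section perturbation.
Variables (S : {linear X -> X}) (N : set X) (K : R).
Hypotheses (bS : bounded_by K S) (kS : kato_mod S N).

Let cN : closed N. Proof. by case: kS. Qed.
Let sN : is_subspace N. Proof. by case: kS. Qed.

(** The preimage in X of the intersection of the ranges of the powers of the
    operator induced on X / N. *)
Definition gen_range := \bigcap_n addset (range (iter n S)) N.
Local Notation Z := gen_range.

Lemma gen_range_closed : closed Z.
Proof. by apply: closed_bigI => n _; case: kS. Qed.

Lemma gen_range_sub : is_subspace Z.
Proof.
have h n : is_subspace (addset (range (iter n S)) N).
  by apply: is_subspace_add => //; exact: is_subspace_range.
split=> [n _|a x y Zx Zy n _]; first exact: sub0 (h n).
by apply: (h n).2; [exact: Zx|exact: Zy].
Qed.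

Lemma gen_range_N : N `<=` Z.
Proof. by move=> x Nx n _; apply: addset_r => //; exact: is_subspace_range. Qed.

Lemma gen_range_stable x : Z x -> Z (S x).
Proof.
move=> Zx n _; have [_ [y [[u _ <-] Ny ->]]] := Zx n I.
exists (iter n S (S u)), (S y); split; [by exists (S u)| |].
  by case: kS => _ _ + _ _; exact.
by rewrite linearD -iterSr iterS.
Qed.

(** The kernel of the induced operator lies in all the ranges, hence in their
    intersection. *)
Lemma gen_range_preimage x : Z (S x) -> Z x.
Proof.
move=> Zx n _; have [_ [y [[u _ <-] Ny e]]] := Zx n.+1 I.
have : addset (range (iter n S)) N (x - iter n S u).
  case: kS => _ _ _ _; apply; rewrite linearB e iterS.
  by have -> : S (iter n S u) + y - S (iter n S u) = y by zmod_eq.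
move=> h; rewrite -[x](subrK (iter n S u)); apply: subD => //.
  by apply: is_subspace_add => //; exact: is_subspace_range.
by apply: addset_l => //; exists u.
Qed.

Lemma kato_mod_solve : exists2 C : R, 0 < C & forall z,
  addset (range S) N z -> exists x n, [/\ N n, z = S x + n & nrm x <= C * nrm z].
Proof.
have [|C C0 h] := @open_mapping R X S K setT N bS closedT (is_subspaceT _) cN sN.
  by case: kS => _ _ _ /(_ 1%N).
exists (C + 1) => [|z /h[x [n [_ Nn e nx]]]]; first by rewrite ltr_wpDl.
by exists x, n; split=> //; rewrite mulrDl mul1r ler_wpDr// nrm_ge0.
Qed.

(** For small [l] one constant serves all the equations (S - l) x = z modulo [N]:
    up to [N], [S - l] maps [Z] onto itself, and it is bounded below modulo [Z],
    both properties being stable under small perturbations. *)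
Lemma shift_solve : exists e C : R, [/\ 0 < e, 0 <= C &
  forall l, nrm l <= e ->
    (forall z, Z z -> exists w n, [/\ Z w, N n & z = shift S l w + n]) /\
    forall z, addset (range (shift S l)) N z ->
      exists x n, [/\ N n, z = shift S l x + n & nrm x <= C * nrm z]].
Proof.
have [C0 C0p hC0] := kato_mod_solve.
have [K0 _] := bS; have ZN := gen_range_N; have sZ := gen_range_sub.
have eC0 : (2 * C0)^-1 * (2 * C0) = 1 by rewrite mulVf// gt_eqF// mulr_gt0.
pose K' := K + (2 * C0)^-1.
pose C := 3 * C0 + 2 * C0 * (1 + K' * (3 * C0)).
have e0 : 0 < (2 * C0)^-1 by rewrite invr_gt0 mulr_gt0.
have K'0 : 0 <= K' by rewrite addr_ge0// ltW.
exists (2 * C0)^-1, C; split=> //; first by rewrite /C; nra.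
move=> l hl; have lC0 : nrm l * C0 <= 2^-1.
  by have := ler_wpM2r (ltW C0p) hl; lra.
have l0 := nrm_ge0 l.
have solZ z : Z z -> exists w n,
    [/\ Z w, N n, z = shift S l w + n & nrm w <= 2 * C0 * nrm z].
  apply: (@solve_of_approx R X (shift S l) (K + nrm l) Z N Z C0) => //.
  - exact: bounded_shift.
  - exact: gen_range_closed.
  - exact: ltW.
  move=> {}z Zz; have [w [n [Nn e nw]]] := hC0 z (Zz 1%N I).
  have Zw : Z w.
    apply: gen_range_preimage; have -> : S w = z - n by rewrite e addrK.
    by apply: (subB sZ) => //; exact: ZN.
  have rE : z - shift S l w - n = l *: w by rewrite /shift e; zmod_eq.
  exists w, n; rewrite rE; split=> //; last exact: (subZ sZ).
  by rewrite nrmZ; have := nrm_ge0 z; nra.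
split=> [z /solZ[w [n [Zw Nn e _]]]|z [_ [n [[x _ <-] Nn e]]]]; first by exists w, n.
have [z0|z0] := eqVneq z 0.
  by exists 0, 0; rewrite z0 linear0 addr0 !nrm0 mulr0; split=> //; exact: sub0.
have nz := nrm_gt0 z0.
(* x is within 3 * C0 * nrm z of Z: halve the excess over 2 * C0 * nrm z
   repeatedly. *)
have dist k : exists2 w, Z w & nrm (x - w) <= 2 * C0 * nrm z + half R k * nrm x.
  elim: k => [|k [w Zw hw]].
    exists 0; first exact: (sub0 sZ).
    by rewrite subr0 half0 mul1r lerDr; apply: mulr_ge0; lra.
  (* S x = l x + (z - n) is close to l w - n, which lies in Z. *)
  have Zy : Z (l *: w - n) by apply: (subB sZ) => //; [exact: (subZ sZ)|exact: ZN].
  have eS : S x - (l *: w - n) = z + l *: (x - w).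
    by rewrite e /shift scalerBr; zmod_eq.
  have [|x' [n' [Nn' e' nx']]] := hC0 (S x - (l *: w - n)).
    have [_ [m [[u _ <-] Nm ->]]] := Zy 1%N I.
    exists (S (x - u)), (- m); split; [by exists (x - u)|exact: subN|].
    by rewrite linearB; zmod_eq.
  exists (x - x'); last first.
    have -> : x - (x - x') = x' by zmod_eq.
    apply: le_trans nx' _; rewrite eS halfS.
    have := nrmD z (l *: (x - w)); rewrite nrmZ; have := nrm_ge0 (x - w).
    nra.
  apply: gen_range_preimage.
  have -> : S (x - x') = (l *: w - n) + n'.
    by rewrite linearB; have -> : S x = S x' + n' + (l *: w - n); [rewrite -e' subrK|zmod_eq].
  by apply: (subD sZ) => //; exact: ZN.
have [w Zw hw] : exists2 w, Z w & nrm (x - w) <= 3 * C0 * nrm z.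
  have [k hk] := half_small_mul (nrm x) (mulr_gt0 C0p nz).
  by have [w Zw hw] := dist k; exists w => //; lra.
have [|w' [n' [Zw' Nn' e' nw']]] := solZ (z - shift S l (x - w)).
  have -> : z - shift S l (x - w) = S w - l *: w + n.
    by rewrite [shift S l (x - w)]linearB /= e /shift; zmod_eq.
  apply: (subD sZ) => //; last exact: ZN.
  by apply: (subB sZ) => //; [exact: gen_range_stable|exact: (subZ sZ)].
exists (x - w + w'), n'; split=> //.
  by rewrite linearD -addrA -e' addrC subrK.
have h1 : nrm (shift S l (x - w)) <= K' * (3 * C0 * nrm z).
  have [_ h] := bounded_shift l bS; apply: le_trans (h _) _.
  by apply: ler_pM => //; [rewrite addr_ge0|exact: nrm_ge0|rewrite lerD2l].
have h2 : nrm (z - shift S l (x - w)) <= nrm z + K' * (3 * C0 * nrm z).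
  by apply: le_trans (nrmD _ _) _; rewrite nrmN lerD2l.
apply: le_trans (nrmD _ _) _; rewrite /C.
have : 2 * C0 * nrm (z - shift S l (x - w)) <=
  2 * C0 * (nrm z + K' * (3 * C0 * nrm z)) by rewrite ler_wpM2l//; lra.
lra.
Qed.

End perturbation.

(** A property of complex numbers that is insensitive to small moves is constant
    on a disc: walk along a segment in equal small steps. *)
Lemma chain_disc (P : R[i] -> Prop) (e h : R) : 0 < h ->
  (forall l m, nrm l <= e -> nrm m <= e -> nrm (l - m) <= h -> P l -> P m) ->
  forall l m, nrm l <= e -> nrm m <= e -> P l -> P m.
Proof.
move=> h0 step l m le_ me Pl.
pose J := (Num.truncn (nrm (m - l) / h)).+1.
have J0 : 0 < J%:R :> R by rewrite ltr0n.
have hJ : nrm (m - l) <= h * J%:R.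
  by rewrite mulrC -ler_pdivrMr//; exact/ltW/truncnS_gt.
pose p (j : nat) := l + (j%:R / J%:R)%:C * (m - l).
have pe j : (j <= J)%N -> nrm (p j) <= e.
  move=> jJ; set t : R := j%:R / J%:R.
  have t0 : 0 <= t by rewrite divr_ge0// ltW.
  have t1 : t <= 1 by rewrite ler_pdivrMr// mul1r ler_nat.
  have -> : p j = (1 - t)%:C * l + t%:C * m.
    by rewrite /p -/t rmorphB /=; ring.
  apply: le_trans (nrmD _ _) _; rewrite !nrmM !nrmR !ger0_norm ?subr_ge0//; nra.
have Pp j : (j <= J)%N -> P (p j).
  elim: j => [_|j IH jJ]; first by rewrite /p mul0r mul0r addr0.
  apply: step (IH (ltnW jJ)); [exact/pe/ltnW|exact: pe|].
  have -> : p j - p j.+1 = - ((J%:R)^-1)%:C * (m - l).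
    by rewrite /p -natr1 mulrDl mul1r rmorphD /=; ring.
  rewrite nrmM nrmN nrmR ger0_norm; last by rewrite invr_ge0 ltW.
  by rewrite mulrC ler_pdivrMr.
have -> : m = p J by rewrite /p divff ?gt_eqF// rmorph1 mul1r addrC subrK.
exact: Pp.
Qed.

End kato.

(** * The punctured neighbourhood theorem *)

Section punctured.
Variables (R : realType) (X : completeNormedModType R[i]).
Implicit Types (S A : {linear X -> X}) (N U V : set X) (x y z w : X) (l m : R[i]).

(** A solution bound uniform in [l] makes kernels and ranges of [S - l] vary
    continuously in the gap, so their (co)dimensions modulo [N] do not change. *)
Lemma kato_mod_shift S N K : bounded_by K S -> kato_mod S N ->
  exists2 e : R, 0 < e & forall l m, nrm l <= e -> nrm m <= e ->
    [/\ closed (addset (range (shift S l)) N),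
        forall z, gen_range S N z -> exists w n,
          [/\ gen_range S N w, N n & z = shift S l w + n],
        qdim [set x | N (shift S l x)] N = qdim [set x | N (shift S m x)] N &
        qdim setT (addset (range (shift S l)) N) =
        qdim setT (addset (range (shift S m)) N)].
Proof.
move=> bS kS; have [cN sN _ _ _] := kS.
have [e [C [e0 C0 hC]]] := shift_solve bS kS; exists e => //.
have cR l : nrm l <= e -> closed (addset (range (shift S l)) N).
  move=> le_; apply: (closed_of_solve (bounded_shift l bS) closedT (is_subspaceT _) cN sN C0).
  by move=> z /((hC l le_).2)[x [n [Nn ez nx]]]; exists x, n.
have sM l : is_subspace [set x | N (shift S l x)].
  split=> [|a x y Nx Ny] /=; first by rewrite linear0; exact: sub0.
  by rewrite linearP; exact: sN.2.
have hkey n : exists2 h : R, 0 < h & forall l m, nrm l <= e -> nrm m <= e ->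
    nrm (l - m) <= h ->
    (dim_ge [set x | N (shift S l x)] N n -> dim_ge [set x | N (shift S m x)] N n) /\
    (dim_ge setT (addset (range (shift S l)) N) n ->
     dim_ge setT (addset (range (shift S m)) N) n).
  have [d d0 hd] := gap_dim X n.
  have C10 : 0 < C + 1 by rewrite ltr_wpDl.
  exists (d / (C + 1)); first by rewrite divr_gt0.
  move=> l m le_ me; rewrite ler_pdivlMr// => lm.
  have lm0 := nrm_ge0 (l - m).
  have lmC : C * nrm (l - m) <= d by rewrite mulrDr mulr1 mulrC in lm; lra.
  split; apply: hd => //.
  - move=> x Nx /=; case: kS => _ _ hN _ _.
    by apply: subB => //; [exact: hN|exact: subZ].
  - move=> u Mu; have [|x [k [Nk ez nx]]] := (hC m me).2 ((l - m) *: u).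
      exists (shift S m u), (- shift S l u); split; [by exists u|exact: subN|].
      by rewrite /shift scalerBl; zmod_eq.
    exists (u - x).
      have -> : [set x | N (shift S m x)] (u - x) = N (shift S l u + k).
        congr N; rewrite linearB /=.
        have -> : k = (l - m) *: u - shift S m x by rewrite ez addrC addKr.
        by rewrite /shift scalerBl; zmod_eq.
      exact: subD.
    have -> : u - (u - x) = x by zmod_eq.
    apply: le_trans nx _; rewrite nrmZ mulrA.
    by rewrite ler_wpM2r ?nrm_ge0.
  - move=> v Nv; exists v => //; rewrite subrr nrm0 mulr_ge0 ?nrm_ge0//.
    exact: ltW.
  - exact: cR.
  - by apply: is_subspace_add => //; exact: is_subspace_range.
  - move=> u _; exists u => //; rewrite subrr nrm0 mulr_ge0 ?nrm_ge0//.
    exact: ltW.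
  - move=> v /((hC m me).2)[x [k [Nk ez nx]]].
    exists (shift S l x + k); first by exists (shift S l x), k; split=> //; exists x.
    have -> : shift S l x + k - v = - ((l - m) *: x).
      by rewrite ez /shift scalerBl; zmod_eq.
    rewrite nrmN nrmZ; apply: le_trans (ler_wpM2l lm0 nx) _.
    by rewrite mulrCA mulrA ler_wpM2r ?nrm_ge0.
have hM l m n : nrm l <= e -> nrm m <= e ->
    dim_ge [set x | N (shift S l x)] N n -> dim_ge [set x | N (shift S m x)] N n.
  have [h h0 hh] := hkey n.
  apply: (@chain_disc R (fun k => dim_ge [set x | N (shift S k x)] N n) e h h0).
  by move=> l' m' le' me' lm'; case: (hh l' m' le' me' lm').
have hR l m n : nrm l <= e -> nrm m <= e ->
    dim_ge setT (addset (range (shift S l)) N) n ->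
    dim_ge setT (addset (range (shift S m)) N) n.
  have [h h0 hh] := hkey n.
  apply: (@chain_disc R (fun k => dim_ge setT (addset (range (shift S k)) N) n) e h h0).
  by move=> l' m' le' me' lm'; case: (hh l' m' le' me' lm').
move=> l m le_ me; split; [exact: cR|exact: (hC l le_).1| |]; apply: eq_qdim => n.
  by split; exact: hM.
by split; exact: hR.
Qed.

Lemma nullityE A : nullity A = ldim (null_space A).
Proof. by rewrite /nullity /nullity_on setTI. Qed.

(** [S - m] is invertible on the kernel of a power of [S] when [m] is not 0, so
    that dividing this kernel out changes neither its kernel nor its corange. *)
Theorem punctured_neighbourhood S K d : bounded_by K S ->
  kato_mod S (null_space (iter d S)) ->
  exists (e : R) (a b : \bar R), 0 < e /\ forall m, m != 0 -> nrm m <= e ->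
    [/\ kato (shift S m), nullity (shift S m) = a & defect (shift S m) = b].
Proof.
set N := null_space _ => bS kS; have [cN sN _ _ _] := kS.
have [e e0 h] := kato_mod_shift bS kS.
exists e, (qdim [set x | N (shift S 0 x)] N),
  (qdim setT (addset (range (shift S 0)) N)); split=> // m m0 me.
have [|cR hZ qM qR] := h m 0 me; first by rewrite nrm0 ltW.
have sR : is_subspace (range (shift S m)) := is_subspace_range _.
have NR : N `<=` range (shift S m).
  by move=> n /(shift_null_onto m0)[n' _ <-]; exists n'.
have RE : addset (range (shift S m)) N = range (shift S m).
  apply/seteqP; split=> [_ [y [n [Ry /NR Rn ->]]]|y Ry]; first exact: (subD sR).
  exact: addset_l.
have ZR : gen_range S N `<=` [set x | exists2 w, gen_range S N w & shift S m w = x].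
  move=> _ /hZ[w [n [Zw /(shift_null_onto m0)[n' Nn' <-] ->]]].
  exists (w + n'); last by rewrite linearD.
  by apply: (subD (gen_range_sub kS)) => //; exact: gen_range_N.
have kerZ : null_space (shift S m) `<=` gen_range S N.
  move=> x /eigen_iter hx n _; apply: addset_l => //.
  by exists (m ^- n *: x) => //; rewrite linearZ /= hx scalerK ?expf_neq0.
split; last by rewrite -qR RE.
  split=> [|n x /kerZ Zx]; first by rewrite -RE.
  suff [w _ <-] : exists2 w, gen_range S N w & iter n (shift S m) w = x by exists w.
  elim: n => [|n [w Zw <-]]; first by exists x.
  by have [w' Zw' <-] := ZR _ Zw; exists w' => //; rewrite iterSr.
rewrite nullityE -qM; apply: eq_qdim => n; split=> [[x [hx ix]]|[x [hx ix]]].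
- exists x; split=> [i|c Nc]; first by rewrite /= (hx i); exact: sub0.
  apply: ix => /=; have : shift S m (\sum_i c i *: x i) = 0.
    by rewrite linear_sum big1// => i _; rewrite linearZ /= (hx i) scaler0.
  move=> /(eigen_iter d); rewrite Nc => /esym/eqP.
  by rewrite scaler_eq0 expf_eq0 (negPf m0) andbF => /eqP.
- have /choice[k hk] i : exists k, N k /\ shift S m k = shift S m (x i).
    by have [k Nk ek] := shift_null_onto m0 (hx i); exists k.
  exists (fun i => x i - k i); split=> [i|c /= c0].
    by rewrite /null_space /= linearB /= (hk i).2 subrr.
  apply: ix; have -> : \sum_i c i *: x i = \sum_i c i *: k i.
    apply/subr0_eq; rewrite -sumrB -[RHS]c0; apply: eq_bigr => i _.
    by rewrite scalerBr.
  by apply: sub_sum => // i _; apply: subZ => //; case: (hk i).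
Qed.

(** ** Operators with topological uniform descent *)

Lemma bounded_iter S K n : bounded_by K S -> bounded_by (K ^+ n) (iter n S).
Proof.
move=> [K0 hK]; split=> [|x]; first exact: exprn_ge0.
elim: n => [|n IH]; first by rewrite expr0 mul1r.
rewrite iterS; apply: le_trans (hK _) _; rewrite exprS -mulrA.
exact: ler_wpM2l.
Qed.

Lemma closed_null A K : bounded_by K A -> closed (null_space A).
Proof.
move=> [K0 hK]; apply/closed_nrm => x hx; apply: nrm0_eq0.
apply/eqP; rewrite eq_le nrm_ge0 andbT; apply/ler_addgt0Pr => e e0.
have K1 : 0 < K + 1 by rewrite ltr_wpDl.
have [y Ay xy] := hx (e / (K + 1)) (divr_gt0 e0 K1).
have -> : A x = A (x - y) by rewrite linearB /= Ay subr0.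
rewrite add0r; apply: le_trans (hK _) _.
rewrite ltr_pdivlMr// in xy; have := nrm_ge0 (x - y); nra.
Qed.

Lemma range_norm_le S d x : range_norm d S (iter d S x) <= nrm x.
Proof. by apply: ge_inf; [exists 0 => _ [y _ <-]; exact: nrm_ge0|exists x]. Qed.

Lemma range_norm_lt S d y (e : R) : range (iter d S) y -> range_norm d S y < e ->
  exists2 x, y = iter d S x & nrm x < e.
Proof.
move=> [x0 _ e0] h; apply: contrapT => hn; move: h; apply/negP; rewrite -leNgt.
apply: lb_le_inf; first by exists (nrm x0), x0 => //; rewrite /= e0.
move=> _ [x /= ex <-]; rewrite leNgt; apply/negP => xe; apply: hn.
by exists x.
Qed.

(** Through [iter d S] the range norm on R(S^d) is the quotient norm of X / N, where
    [N] is the kernel of [iter d S], and the sets closed for it correspond to the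
    closed sets R(S^n) + N. The same map turns the equalities between the
    intersections of R(S^n) and N(S) into the inclusion of the kernel of the
    induced operator in its ranges. *)
Lemma TUD_kato_mod S K : bounded_by K S -> TUD S ->
  exists d, kato_mod S (null_space (iter d S)).
Proof.
move=> bS [d hd]; exists d.
have sN : is_subspace (null_space (iter d S)) := is_subspace_null _.
have sR n : is_subspace (range (iter n S)) := is_subspace_range _.
split=> //; first exact: closed_null (bounded_iter d bS).
- by move=> x; rewrite /null_space /= -iterSr iterS => ->; rewrite linear0.
- move=> n; apply/closed_nrm => x hx.
  have [_ cR] := hd (d + n)%N (leq_addr _ _).
  have [||u _ eu] := cR (iter d S x).
  + by exists x.
  + move=> e e0; have [_ [_ [k [[u _ <-] Nk ->]]] xe] := hx e e0.
    exists (iter d S (iter n S u)); first by exists u; rewrite // iterD.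
    apply: le_lt_trans xe; have := range_norm_le S d (x - (iter n S u + k)).
    by rewrite linearB linearD /= Nk addr0.
  exists (iter n S u), (x - iter n S u); split; [by exists u| |by rewrite addrC subrK].
  by rewrite /null_space /= linearB /= -eu iterD subrr.
- move=> n x Nx.
  have stab k : range (iter d S) `&` null_space S `<=` range (iter (d + k) S).
    elim: k => [|k IH]; first by rewrite addn0 => ? [].
    move=> y [Ry Sy]; have [q0 _] := hd (d + k)%N (leq_addr _ _).
    have sI : is_subspace (range (iter (d + k).+1 S) `&` null_space S).
      by apply: is_subspaceI => //; exact: is_subspace_null.
    have Iy : (range (iter (d + k) S) `&` null_space S) y.
      by split=> //; exact: IH.
    by rewrite addnS; case: ((qdim_eq0P _ sI).1 q0 y Iy).
  have [|u _ eu] := stab n (iter d S x).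
    by split; [exists x|rewrite /null_space /= -iterS iterSr].
  exists (iter n S u), (x - iter n S u); split; [by exists u| |by rewrite addrC subrK].
  by rewrite /null_space /= linearB /= -eu iterD subrr.
Qed.

End punctured.

(** * Semi-Fredholm conditions imply topological uniform descent *)

Section uniform_descent.
Variables (R : realType) (X : completeNormedModType R[i]).
Implicit Types (S A : {linear X -> X}) (D N U V : set X) (x y z u v w : X).

Lemma closed_set0 : closed [set (0 : X)].
Proof.
apply/closed_nrm => x hx; apply: nrm0_eq0; apply/eqP.
rewrite eq_le nrm_ge0 andbT; apply/ler_addgt0Pr => e e0.
by have [_ -> xe] := hx e e0; rewrite add0r -[x]subr0 ltW.
Qed.

Lemma addset0 U : addset U [set 0] = U.
Proof.
apply/seteqP; split=> [_ [x [_ [Ux -> ->]]]|x Ux]; first by rewrite addr0.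
by exists x, 0; rewrite addr0.
Qed.

Lemma add0set U : addset [set 0] U = U.
Proof.
apply/seteqP; split=> [_ [_ [y [-> Uy ->]]]|x Ux]; first by rewrite add0r.
by exists 0, x; rewrite add0r.
Qed.

Lemma closed_span n (x : 'I_n -> X) : closed (span x).
Proof.
rewrite -[span x]add0set; apply: closed_add_span; first exact: closed_set0.
exact: is_subspace0.
Qed.

Lemma span_sub V n (x : 'I_n -> X) : is_subspace V -> (forall i, V (x i)) ->
  span x `<=` V.
Proof. by move=> sV Vx _ [c ->]; apply: sub_sum => // i _; exact: subZ. Qed.

Lemma is_subspace_image A D : is_subspace D -> is_subspace (A @` D).
Proof.
move=> sD; split; first by exists 0; [exact: sub0|rewrite linear0].
move=> a _ _ [x Dx <-] [y Dy <-]; exists (a *: x + y); first exact: sD.2.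
by rewrite linearP.
Qed.

Lemma closed_range_solve A K : bounded_by K A -> closed (range A) ->
  exists2 C : R, 0 <= C & forall z, range A z -> exists2 x, z = A x & nrm x <= C * nrm z.
Proof.
move=> bA cR.
have [|C C0 h] := open_mapping bA closedT (is_subspaceT _) closed_set0 (is_subspace0 _).
  by rewrite addset0.
exists C => // z; rewrite -[range A]addset0 => /h[x [_ [_ -> -> nx]]].
by exists x; rewrite addr0 // -[A x]addr0.
Qed.

(** By the open mapping theorem a limit of points A w, with [w] in [D], is A x for
    some [x] in the closure of D + N(A), and this sum is already closed. *)
Lemma closed_image_finite_null A K D : bounded_by K A -> closed (range A) ->
  (nullity A < +oo)%E -> closed D -> is_subspace D -> closed (A @` D).
Proof.
move=> bA cR fA cD sD.
have sN : is_subspace (null_space A) := is_subspace_null _.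
have [C C0 hC] := closed_range_solve bA cR.
rewrite nullityE in fA.
have [|n [v [Nv _ hv]]] := finite_complement sN (is_subspace0 X) _ fA.
  by move=> _ ->; exact: sub0.
rewrite add0set in hv.
have cDN : closed (addset D (null_space A)).
  have -> : null_space A = span v.
    by apply/seteqP; split=> //; exact: span_sub.
  exact: closed_add_span.
apply/closed_nrm => z hz.
have [x _ xz] : range A z.
  apply: (closed_nrm _).1 cR _ _ => e e0; have [y [w _ <-] yz] := hz e e0.
  by exists (A w) => //; exists w.
have [d [k [Dd Nk xE]]] : addset D (null_space A) x.
  apply: (closed_nrm _).1 cDN _ _ => e e0.
  have C10 : 0 < C + 1 by rewrite ltr_wpDl.
  have [_ [w Dw <-]] := hz _ (divr_gt0 e0 C10); rewrite ltr_pdivlMr// => zw.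
  have [|u zu nu] := hC (z - A w); first by exists (x - w); rewrite // linearB /= xz.
  exists (w + (x - w - u)).
    exists w, (x - w - u); split=> //.
    by rewrite /null_space /= 2!linearB /= xz -zu subrr.
  have -> : x - (w + (x - w - u)) = u by zmod_eq.
  by apply: le_lt_trans nu _; have := nrm_ge0 (z - A w); lra.
by exists d => //; rewrite -xz xE linearD /= Nk addr0.
Qed.

(** By the open mapping theorem the decomposition of [D] into A(D) and a finite
    dimensional complement is bounded, so the component of a limit point of A(D)
    in the complement is 0. *)
Lemma closed_image_finite_codim A K D : bounded_by K A -> closed D ->
  is_subspace D -> A @` D `<=` D -> (qdim D (A @` D) < +oo)%E -> closed (A @` D).
Proof.
move=> bA cD sD AD fD; have sAD := is_subspace_image A sD.
have [n [v [Dv iv hv]]] := finite_complement sD sAD AD fD.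
have FE : addset (A @` D) (span v) = D.
  apply/seteqP; split=> // _ [y [k [/AD Dy vk ->]]].
  by apply: subD => //; exact: span_sub vk.
have [|C C0 hC] := open_mapping bA cD sD (@closed_span _ v) (is_subspace_span v).
  by rewrite FE.
rewrite FE in hC.
apply/closed_nrm => z hz.
have Dz : D z.
  apply: (closed_nrm _).1 cD _ _ => e e0; have [y /AD Dy yz] := hz e e0.
  by exists y.
have [x [k [Dx vk zE _]]] := hC z Dz.
suff k0 : k = 0 by exists x => //; rewrite zE k0 addr0.
apply: nrm0_eq0; apply/eqP; rewrite eq_le nrm_ge0 andbT.
apply/ler_addgt0Pr => e e0; rewrite add0r.
have [K0 hK] := bA.
have C10 : 0 < 1 + K * C by rewrite ltr_wpDr// mulr_ge0.
have [_ [u Du <-]] := hz _ (divr_gt0 e0 C10); rewrite ltr_pdivlMr// => zu.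
have Au : D (A u) by apply: AD; exists u.
have [x' [k' [Dx' vk' zE' nx']]] := hC (z - A u) (subB sD Dz Au).
have -> : k = k'.
  have [c hc] : span v (k - k') by apply: subB => //; exact: is_subspace_span.
  have c0 : forall i, c i = 0.
    apply: iv; rewrite -hc; exists (u + x' - x).
      by apply: subB => //; exact: subD.
    have -> : k = z - A x by rewrite zE; zmod_eq.
    have -> : k' = z - A u - A x' by rewrite zE'; zmod_eq.
    by rewrite linearB linearD; zmod_eq.
  apply/subr0_eq; rewrite hc big1// => i _; by rewrite c0 scale0r.
have -> : k' = (z - A u) - A x' by rewrite zE'; zmod_eq.
apply: le_trans (nrmD _ _) _; rewrite nrmN.
have := hK x'; have := nrm_ge0 x'; have := nrm_ge0 (z - A u); nra.
Qed.

(** The range norm dominates a multiple of the norm of X. *)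
Lemma range_norm_closed_closed S K d U : bounded_by K S -> closed U ->
  U `<=` range (iter d S) -> range_norm_closed d S U.
Proof.
move=> /(bounded_iter d)[K0 hK] cU UR y Ry h.
apply: (closed_nrm _).1 cU _ _ => e e0.
have K1 : 0 < K ^+ d + 1 by rewrite ltr_wpDl.
have [z Uz] := h _ (divr_gt0 e0 K1); move=> /range_norm_lt[|x yx].
  move: Ry (UR _ Uz) => [a _ <-] [b _ <-]; exists (a - b) => //.
  by rewrite linearB.
rewrite ltr_pdivlMr// => nx; exists z => //.
by rewrite yx; apply: le_lt_trans (hK x) _; have := nrm_ge0 x; lra.
Qed.

Lemma TUD_of_closed_ranges S K : bounded_by K S ->
  (exists d, forall n, (d <= n)%N -> closed (range (iter n S)) /\
     range (iter n S) `&` null_space S `<=` range (iter n.+1 S)) ->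
  TUD S.
Proof.
move=> bS [d hd]; exists d => n dn; have [cR kR] := hd n dn; split.
  apply/qdim_eq0P.
    by apply: is_subspaceI; [exact: is_subspace_range|exact: is_subspace_null].
  by move=> x [Rx Nx]; split=> //; exact: kR.
by apply: range_norm_closed_closed bS cR _; exact: range_iter_le.
Qed.

Lemma upper_semi_Fredholm_TUD S K : bounded_by K S ->
  upper_semi_Fredholm S -> TUD S.
Proof.
move=> bS [fS cR]; apply: (TUD_of_closed_ranges bS).
have cRn n : closed (range (iter n S)).
  elim: n => [|n IH].
    have -> : range (iter 0 S) = setT by apply/seteqP; split=> // x _; exists x.
    exact: closedT.
  have -> : range (iter n.+1 S) = S @` range (iter n S) by rewrite image_comp.
  by apply: (closed_image_finite_null bS cR fS IH); exact: is_subspace_range.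
have sR n : is_subspace (range (iter n S)) := is_subspace_range _.
apply: contrapT => hn.
have drop d : exists n y, [/\ (d <= n)%N, range (iter n S) y, S y = 0 &
    ~ range (iter n.+1 S) y].
  apply: contrapT => h; apply: hn; exists d => n dn; split=> // y [Ry Sy].
  by apply: contrapT => nRy; apply: h; exists n, y.
(* Each strict inclusion between consecutive intersections of R(S^n) and N(S) gives
   one more independent vector in N(S). *)
have big j : exists m, dim_ge (null_space S) (range (iter m S)) j.
  elim: j => [|j [m [x [Nx ix]]]]; first by exists 0%N; exact: dim_ge0.
  have [n [y [mn Ry Sy nRy]]] := drop m.
  exists n.+1, (snoc x y); split.
    by apply: ord_max_ind => [|i]; rewrite ?snoc_max ?snoc_widen.
  apply: independent_snoc => c a Rca.
  have Rm : range (iter m S) (\sum_i c i *: x i + a *: y).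
    exact: range_iter_le (leqW mn) _ Rca.
  have c0 : forall i, c i = 0.
    apply: ix; have -> : \sum_i c i *: x i = (\sum_i c i *: x i + a *: y) - a *: y.
      by rewrite addrK.
    apply: (subB (sR m)) => //; apply: (subZ (sR m)).
    exact: range_iter_le mn _ Ry.
  split=> //; apply/eqP/negPn/negP => a0; apply: nRy.
  rewrite big1 ?add0r in Rca; last by move=> i _; rewrite c0 scale0r.
  by rewrite -[y](scalerK a0); exact: (subZ (sR n.+1)).
rewrite nullityE in fS; have [n] := (qdim_ltyP _ _).1 fS; apply.
have [m [x [Nx ix]]] := big n; exists x; split=> // c /= c0.
by apply: ix; rewrite c0; exact: sub0 (sR m).
Qed.

Lemma TUD_of_finite_descent_step S K n : bounded_by K S ->
  closed (range (iter n S)) ->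
  (qdim (range (iter n S)) (range (iter n.+1 S)) < +oo)%E -> TUD S.
Proof.
move=> bS cR fR; apply: (TUD_of_closed_ranges bS).
have sR m : is_subspace (range (iter m S)) := is_subspace_range _.
have lift (m j : nat) (x : 'I_j -> X) : (forall i, range (iter m.+1 S) (x i)) ->
    independent_mod (range (iter m.+2 S)) x ->
    exists u : 'I_j -> X, (forall i, range (iter m S) (u i)) /\
      forall c (w : X), S w = 0 -> range (iter m.+1 S) (\sum_i c i *: u i + w) ->
        forall i, c i = 0.
  move=> Rx ix.
  have /choice[u hu] i : exists u, range (iter m S) u /\ S u = x i.
    by have [w _ <-] := Rx i; exists (iter m S w); split=> //; exists w.
  exists u; split=> [i|c w Sw [w' _ e]]; first by case: (hu i).
  apply: ix; have -> : \sum_i c i *: x i = S (\sum_i c i *: u i + w).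
    rewrite linearD /= Sw addr0 linear_sum; apply: eq_bigr => i _.
    by rewrite linearZ /= (hu i).2.
  by exists w' => //; rewrite iterS e.
have step m j : dim_ge (range (iter m.+1 S)) (range (iter m.+2 S)) j ->
    dim_ge (range (iter m S)) (range (iter m.+1 S)) j.
  move=> [x [Rx ix]]; have [u [Ru hu]] := lift _ _ _ Rx ix.
  exists u; split=> // c Rc; apply: (hu c 0); first by rewrite linear0.
  by rewrite addr0.
have steps m j k : dim_ge (range (iter (k + m) S)) (range (iter (k + m).+1 S)) j ->
    dim_ge (range (iter m S)) (range (iter m.+1 S)) j.
  by elim: k => [//|k IH]; rewrite addSn => /step; exact: IH.
have [N hN] := (qdim_ltyP _ _).1 fR.
have fRm m : (n <= m)%N -> (qdim (range (iter m S)) (range (iter m.+1 S)) < +oo)%E.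
  move=> nm; apply/qdim_ltyP; exists N => h; apply: hN.
  by apply: (steps _ _ (m - n)%N); rewrite subnK.
have cRm m : (n <= m)%N -> closed (range (iter m S)).
  move=> /subnK <-; elim: (m - n)%N => [//|k IH]; rewrite addSn.
  have E : range (iter (k + n).+1 S) = S @` range (iter (k + n) S).
    by rewrite image_comp.
  rewrite E; apply: (closed_image_finite_codim bS IH) => //.
    by rewrite -E; exact: range_iter_le.
  by rewrite -E; apply: fRm; exact: leq_addl.
apply: contrapT => hn.
have drop d : (n <= d)%N -> exists m y, [/\ (d <= m)%N, range (iter m S) y, S y = 0 &
    ~ range (iter m.+1 S) y].
  move=> nd; apply: contrapT => h; apply: hn; exists d => m dm.
  split; first by apply: cRm; exact: leq_trans dm.
  move=> y [Ry Sy].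
  by apply: contrapT => nRy; apply: h; exists m, y.
(* S induces a map from R(S^m) / R(S^m.+1) onto R(S^m.+1) / R(S^m.+2), and y is in
   its kernel: the dimension decreases at each drop. *)
have big j m : (n <= m)%N -> dim_ge (range (iter m S)) (range (iter m.+1 S)) j.
  elim: j m => [|j IH] m nm; first exact: dim_ge0.
  have [m' [y [mm' Ry Sy nRy]]] := drop m nm.
  apply: (steps _ _ (m' - m)%N); rewrite subnK//.
  have [x [Rx ix]] := IH m'.+1 (leq_trans nm (leqW mm')).
  have [u [Ru hu]] := lift _ _ _ Rx ix.
  exists (snoc u y); split.
    by apply: ord_max_ind => [|i]; rewrite ?snoc_max ?snoc_widen.
  apply: independent_snoc => c a Rca.
  have c0 : forall i, c i = 0.
    by apply: (hu c (a *: y)) => //; rewrite linearZ /= Sy scaler0.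
  split=> //; apply/eqP/negPn/negP => a0; apply: nRy.
  rewrite big1 ?add0r in Rca; last by move=> i _; rewrite c0 scale0r.
  by rewrite -[y](scalerK a0); exact: (subZ (sR m'.+1)).
exact/hN/big.
Qed.

End uniform_descent.

(** * The classes of operators *)

Section inf_nat.
Variable R : realType.
Implicit Types P : set nat.

Lemma inf_nat_lty P : (@inf_nat R P < +oo)%E -> exists n, P n.
Proof. by move=> /ereal_inf_lt[_ [n Pn _] _]; exists n. Qed.

Lemma inf_nat_min P n : P n -> (forall m, P m -> (n <= m)%N) ->
  @inf_nat R P = n%:R%:E.
Proof.
move=> Pn hn; apply/eqP; rewrite eq_le; apply/andP; split.
  by apply: ereal_inf_lbound; exists n.
by apply: le_ereal_inf_tmp => _ [m /hn nm <-]; rewrite lee_fin ler_nat.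
Qed.

Lemma inf_nat_eq P n : @inf_nat R P = n%:R%:E -> P n.
Proof.
move=> e; have [|m0 Pm0] := @inf_nat_lty P; first by rewrite e ltry.
have [m [/asboolP Pm hm]] : exists m, `[< P m >] /\ forall k, `[< P k >] -> (m <= k)%N.
  have ex : exists m, `[< P m >] by exists m0; exact/asboolP.
  by exists (ex_minn ex); case: ex_minnP.
have := inf_nat_min Pm (fun k Pk => hm k (introT (asboolP _) Pk)).
by rewrite e => -[] /eqP; rewrite eqr_nat => /eqP ->.
Qed.

Lemma inf_nat0 P : P 0%N -> @inf_nat R P = 0%:R%:E.
Proof. by move=> P0; exact: inf_nat_min. Qed.

End inf_nat.

Section classes.
Variables (R : realType) (X : completeNormedModType R[i]).
Implicit Types (S A : {linear X -> X}) (x y z : X).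

Lemma range_iter0 S : range (iter 0 S) = setT.
Proof. by apply/seteqP; split=> // x _; exists x. Qed.

Lemma nullity0P A : nullity A = 0%E <-> forall x, A x = 0 -> x = 0.
Proof.
rewrite nullityE /ldim; split=> [/(qdim_eq0P _ (is_subspace0 X)) h x /h //|h].
by apply/(qdim_eq0P _ (is_subspace0 X)) => x /h.
Qed.

Lemma defect0P A : defect A = 0%E <-> surjective_op A.
Proof.
have sR : is_subspace (range A) := is_subspace_range A.
rewrite /surjective_op; split=> [/(qdim_eq0P _ sR) h|h].
  by apply/seteqP; split=> // x _; exact: h.
by apply/(qdim_eq0P _ sR) => x _; rewrite h.
Qed.

Lemma bounded_below_inv A : bounded_below A ->
  exists2 C : R, 0 <= C & forall x, nrm x <= C * nrm (A x).
Proof.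
move=> [[a b]]; rewrite ltcE /= => /andP[/eqP -> a0] h.
exists a^-1 => [|x]; first by rewrite invr_ge0 ltW.
have := h x; rewrite !nrmE -[Complex a 0]/(a%:C) -rmorphM /= lecR => hx.
by rewrite mulrC ler_pdivlMr// mulrC.
Qed.

(** ** Each class implies topological uniform descent *)

Definition implies_TUD (C : (X -> X) -> Prop) :=
  forall S K, bounded_by K S -> C S -> TUD S.

Lemma lower_semi_Fredholm_TUD : implies_TUD (@lower_semi_Fredholm R X).
Proof.
move=> S K bS fS; have := TUD_of_finite_descent_step (n := 0) bS.
by rewrite range_iter0; apply=> //; exact: closedT.
Qed.

Lemma surjective_TUD : implies_TUD (@surjective_op R X).
Proof.
move=> S K bS /defect0P sS; apply: (lower_semi_Fredholm_TUD bS).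
by rewrite /lower_semi_Fredholm sS ltry.
Qed.

Lemma invertible_surjective A : invertible_op A -> surjective_op A.
Proof.
by move=> [A' [_ _ K]]; apply/seteqP; split=> // x _; exists (A' x).
Qed.

Lemma bounded_below_TUD : implies_TUD (@bounded_below R X).
Proof.
move=> S K bS /bounded_below_inv[C C0 hC].
apply: (upper_semi_Fredholm_TUD bS); split.
  have /nullity0P -> // : forall x, S x = 0 -> x = 0.
  move=> x Sx; apply: nrm0_eq0; apply/eqP; rewrite eq_le nrm_ge0 andbT.
  by have := hC x; rewrite Sx nrm0 mulr0.
rewrite -[range S]addset0.
apply: (closed_of_solve bS closedT (is_subspaceT _) (@closed_set0 _ _)
  (is_subspace0 _) C0).
move=> _ [_ [_ [[x _ <-] -> ->]]]; exists x, 0; split=> //.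
by rewrite addr0.
Qed.

Lemma right_Drazin_TUD : implies_TUD (@right_Drazin R X).
Proof.
move=> S K bS [n /inf_nat_eq e cR]; apply: (TUD_of_finite_descent_step bS cR).
have -> : qdim (range (iter n S)) (range (iter n.+1 S)) = 0%E; last exact: ltry.
by apply/qdim_eq0P; [exact: is_subspace_range|rewrite -e].
Qed.

Lemma right_ess_Drazin_TUD : implies_TUD (@right_ess_Drazin R X).
Proof.
move=> S K bS [n /inf_nat_eq fR cR]; exact: (TUD_of_finite_descent_step bS cR).
Qed.

Lemma lower_semi_B_Weyl_TUD : implies_TUD (@lower_semi_B_Weyl R X).
Proof.
move=> S K bS [n [cR fR _]]; apply: (TUD_of_finite_descent_step bS cR).
by move: fR; rewrite /defect_on image_comp.
Qed.

(** ** On Kato operators each class is a condition on nullity and defect *)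

Definition dim_condition (C : (X -> X) -> Prop) :=
  exists phi : \bar R -> \bar R -> Prop,
    forall A K, bounded_by K A -> kato A -> (C A <-> phi (nullity A) (defect A)).

(** A kernel vector of a Kato operator has the form A^n y; if the kernels of A^n and
    A^n.+1 agree, it is 0. *)
Lemma kato_ascent A : kato A -> (ascent A < +oo)%E <-> nullity A = 0%E.
Proof.
move=> [_ kA]; split=> [/inf_nat_lty[n e]|/nullity0P h]; last first.
  rewrite /ascent inf_nat0 ?ltry//.
  by apply/seteqP; split=> x; rewrite /null_space /=;
    [move=> ->; rewrite linear0|exact: h].
apply/nullity0P => x Ax; have [y _ yx] := kA n x Ax.
suff : null_space (iter n A) y by rewrite /null_space /= yx.
by rewrite e /null_space /= yx.
Qed.

Lemma kato_null_iter A n : kato A -> null_space (iter n A) `<=` range A.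
Proof.
move=> [_ kA]; elim: n => [|n IH] x; rewrite /null_space /=.
  by move=> ->; exists 0; rewrite ?linear0.
move=> Ax; have [y _ e] := kA n.+1 _ Ax.
have [|z _ ez] := IH (x - A y).
  by rewrite /null_space /= linearB /= -e iterSr subrr.
by exists (z + y) => //; rewrite linearD /= ez subrK.
Qed.

(** The n-th power of a Kato operator induces an isomorphism from X / R(A) onto
    R(A^n) / R(A^n.+1), as its kernel is contained in R(A). *)
Lemma kato_descent_step A n : kato A ->
  qdim (range (iter n A)) (range (iter n.+1 A)) = defect A.
Proof.
move=> kA; have sR : is_subspace (range A) := is_subspace_range A.
have itS k (c : 'I_k -> R[i]) (u : 'I_k -> X) :
    iter n A (\sum_i c i *: u i) = \sum_i c i *: iter n A (u i).
  by rewrite linear_sum; apply: eq_bigr => i _; rewrite linearZ.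
apply: eq_qdim => k; split=> [[x [Rx ix]]|[x [_ ix]]].
- have /choice[u hu] i : exists u, iter n A u = x i.
    by have [w _ <-] := Rx i; exists w.
  exists u; split=> // c [w _ e]; apply: ix.
  by exists w => //; rewrite iterSr e itS; under eq_bigr do rewrite hu.
- exists (fun i => iter n A (x i)); split=> [i|c [w _ e]]; first by exists (x i).
  apply: ix; rewrite -[\sum_i _](subrK (A w)); apply: (subD sR); last by exists w.
  apply: (kato_null_iter (n := n) kA).
  by rewrite /null_space /= linearB /= itS -e -iterSr subrr.
Qed.

Lemma kato_descent A : kato A -> (descent A < +oo)%E <-> defect A = 0%E.
Proof.
move=> kA; split=> [/inf_nat_lty[n e]|/defect0P h].
  rewrite -(kato_descent_step n kA); apply/qdim_eq0P; first exact: is_subspace_range.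
  by rewrite -e.
have E : range (iter 0 A) = range (iter 1 A) := etrans (range_iter0 A) (esym h).
by rewrite /descent inf_nat0 ?ltry.
Qed.

Lemma kato_bounded_below A K : bounded_by K A -> kato A ->
  bounded_below A <-> nullity A = 0%E.
Proof.
move=> bA [cR _]; split=> [/bounded_below_inv[C _ h]|/nullity0P h].
  apply/nullity0P => x Ax; apply: nrm0_eq0; apply/eqP; rewrite eq_le nrm_ge0 andbT.
  by have := h x; rewrite Ax nrm0 mulr0.
have [C C0 hC] := closed_range_solve bA cR.
have C1 : 0 < C + 1 by rewrite ltr_wpDl.
exists ((C + 1)^-1)%:C => [|x]; first by rewrite ltcR invr_gt0.
rewrite !nrmE -rmorphM /= lecR mulrC ler_pdivrMr//.
have [|y e ny] := hC (A x); first by exists x.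
have -> : x = y by apply/subr0_eq/h; rewrite linearB /= e subrr.
by apply: le_trans ny _; rewrite e; have := nrm_ge0 (A y); lra.
Qed.

Lemma kato_invertible A K : bounded_by K A -> kato A ->
  invertible_op A <-> nullity A = 0%E /\ defect A = 0%E.
Proof.
move=> bA kA; split=> [iA|[n0 d0]].
  split; last exact/defect0P/invertible_surjective.
  apply/nullity0P => x Ax; have [A' [_ K1 _]] := iA.
  by rewrite -[x]K1 Ax linear0.
have [C C0 hC] := bounded_below_inv ((kato_bounded_below bA kA).2 n0).
have sA x : exists y, A y = x.
  by move/defect0P: d0 => e; have : range A x by [rewrite e]; move=> [y _ <-]; exists y.
have [B hB] := choice sA.
have Ainj x y : A x = A y -> x = y.
  by move=> e; apply/subr0_eq; apply: (nullity0P A).1 => //; rewrite linearB /= e subrr.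
have linB : linear B by move=> a x y; apply: Ainj; rewrite linearP !hB.
pose BL : {linear X -> X} := HB.pack B (GRing.isLinear.Build _ _ _ _ B linB).
exists BL; split=> [|x|x]; [|exact/Ainj/hB|exact: hB].
apply/linear_bounded_continuous/linear_boundedP; exists C%:C; split.
  by rewrite realE lecR C0.
move=> r Cr x; apply: (@le_trans _ _ (C%:C * `|x|)).
  by rewrite !nrmE -rmorphM /= lecR; have := hC (B x); rewrite hB.
by rewrite ler_wpM2r// ltW.
Qed.

Lemma dim_condition_and (C1 C2 : (X -> X) -> Prop) :
  dim_condition C1 -> dim_condition C2 -> dim_condition (fun B : X -> X => C1 B /\ C2 B).
Proof.
move=> [p hp] [q hq]; exists (fun a b => p a b /\ q a b) => A K bA kA.
by rewrite (hp A K bA kA) (hq A K bA kA).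
Qed.

Lemma upper_semi_Fredholm_dim : dim_condition (@upper_semi_Fredholm R X).
Proof. by exists (fun a _ => (a < +oo)%E) => A K _ [cR _]; split=> [[]|]. Qed.

Lemma lower_semi_Fredholm_dim : dim_condition (@lower_semi_Fredholm R X).
Proof. by exists (fun _ b => (b < +oo)%E). Qed.

Lemma Fredholm_dim : dim_condition (@Fredholm R X).
Proof.
exact: dim_condition_and upper_semi_Fredholm_dim lower_semi_Fredholm_dim.
Qed.

Lemma upper_semi_Weyl_dim : dim_condition (@upper_semi_Weyl R X).
Proof.
apply: dim_condition_and upper_semi_Fredholm_dim _.
by exists (fun a b => (a - b <= 0)%E).
Qed.

Lemma lower_semi_Weyl_dim : dim_condition (@lower_semi_Weyl R X).
Proof.
apply: dim_condition_and lower_semi_Fredholm_dim _.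
by exists (fun a b => (0 <= a - b)%E).
Qed.

Lemma Weyl_dim : dim_condition (@Weyl R X).
Proof.
apply: dim_condition_and Fredholm_dim _.
by exists (fun a b => (a - b)%E = 0%E).
Qed.

Lemma upper_semi_Browder_dim : dim_condition (@upper_semi_Browder R X).
Proof.
apply: dim_condition_and upper_semi_Fredholm_dim _.
by exists (fun a _ => a = 0%E) => A K _ kA; exact: kato_ascent.
Qed.

Lemma lower_semi_Browder_dim : dim_condition (@lower_semi_Browder R X).
Proof.
apply: dim_condition_and lower_semi_Fredholm_dim _.
by exists (fun _ b => b = 0%E) => A K _ kA; exact: kato_descent.
Qed.

Lemma Browder_dim : dim_condition (@Browder R X).
Proof.
exact: dim_condition_and upper_semi_Browder_dim lower_semi_Browder_dim.
Qed.

Lemma bounded_below_dim : dim_condition (@bounded_below R X).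
Proof. by exists (fun a _ => a = 0%E) => A K; exact: kato_bounded_below. Qed.

Lemma surjective_dim : dim_condition (@surjective_op R X).
Proof. by exists (fun _ b => b = 0%E) => A K _ _; rewrite defect0P. Qed.

Lemma invertible_dim : dim_condition (@invertible_op R X).
Proof.
by exists (fun a b => a = 0%E /\ b = 0%E) => A K; exact: kato_invertible.
Qed.

Lemma right_Drazin_dim : dim_condition (@right_Drazin R X).
Proof.
exists (fun _ b => b = 0%E) => A K _ kA.
rewrite -(kato_descent kA); split=> [[n -> _]|/(kato_descent kA)/defect0P h].
  exact: ltry.
exists 0%N; last by rewrite range_iter0; exact: closedT.
apply: inf_nat0; exact: etrans (range_iter0 A) (esym h).
Qed.

Lemma right_ess_Drazin_dim : dim_condition (@right_ess_Drazin R X).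
Proof.
exists (fun _ b => (b < +oo)%E) => A K _ kA; split=> [[n /inf_nat_eq]|h].
  by rewrite -(kato_descent_step n kA).
exists 0%N; last by rewrite range_iter0; exact: closedT.
by apply: inf_nat0; rewrite -(kato_descent_step 0 kA) in h.
Qed.

(** The range of a power of a Kato operator contains the kernel, so the restriction
    to it has the nullity of the operator itself; for the defect see
    [kato_descent_step]. *)
Lemma lower_semi_B_Weyl_dim : dim_condition (@lower_semi_B_Weyl R X).
Proof.
exists (fun a b => (b < +oo)%E /\ (0 <= a - b)%E) => A K _ kA.
have dE n : defect_on (range (iter n A)) A = defect A.
  by rewrite -(kato_descent_step n kA) /defect_on image_comp.
have nE n : nullity_on (range (iter n A)) A = nullity A.
  by rewrite nullityE /nullity_on setIC setIidl//; exact: kA.2.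
split=> [[n [_]]|[h1 h2]].
  by rewrite /fredholm_index_on nE dE.
exists 0%N; rewrite /fredholm_index_on nE dE range_iter0.
by split=> //; exact: closedT.
Qed.

(** ** Spectra without isolated points and without interior *)

(** Where [T - l] has topological uniform descent, the class of [T - m] is the
    same for all [m] near but different from [l]. A spectrum that accumulates at
    one of its points [l] then contains a neighbourhood of [l]. *)
Lemma spectrum_TUD (C : (X -> X) -> Prop) (T : {linear X -> X}) :
  implies_TUD C -> dim_condition C -> continuous T ->
  spectrum_of C T = boundary (spectrum_of C T) ->
  boundary (spectrum_of C T) = limit_point (spectrum_of C T) ->
  spectrum_of (@TUD R X) T = spectrum_of C T.
Proof.
move=> CT [phi hphi] /continuous_bounded[K bT] sb bl; apply/seteqP; split=> l.
  by move=> nT Cl; apply: nT; exact: (CT (shift T l) _ (bounded_shift l bT)).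
move=> sl /(TUD_kato_mod (S := shift T l) (bounded_shift l bT))[d].
move=> /(punctured_neighbourhood (bounded_shift l bT))[e [a [b [e0 h]]]].
have near m : m != l -> nrm (l - m : R[i]) < e -> C (shift T m) <-> phi a b.
  move=> ml lm; have [||kA nA dA] := h (m - l).
  - by rewrite subr_eq0.
  - by rewrite nrmB ltW.
  have <- : shift (shift T l) (m - l) = shift T m.
    by rewrite shift_add addrC subrK.
  by rewrite -nA -dA; exact: hphi (bounded_shift (m - l) (bounded_shift l bT)) kA.
have [m [ml Cm lm]] : exists m, [/\ m != l, ~ C (shift T m) & nrm (l - m : R[i]) < e].
  have : limit_point (spectrum_of C T) l by rewrite -bl -sb.
  move=> /(_ [set m | nrm (l - m : R[i]^o) < e])[|m [ml sm lm]].
    by apply/nbhs_nrm; exists e.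
  by exists m.
have [_] : boundary (spectrum_of C T) l by rewrite -sb.
apply; apply/nbhs_nrm; exists e => // m' lm' Cm'.
have [ml'|ml'] := eqVneq m' l; first by apply: sl; rewrite -ml'.
by apply: Cm; apply/(near m ml lm)/(near m' ml' lm').
Qed.

End classes.

Theorem corollary4p8 (R : realType) (X : completeNormedModType R[i])
    (T : {linear X -> X}) (sigma : (X -> X) -> set R[i]^o) :
  ldim [set: X] = +oo%E ->
  continuous T ->
  [set spectrum_of (@upper_semi_Weyl R X); spectrum_of (@lower_semi_Weyl R X);
       spectrum_of (@Weyl R X); spectrum_of (@lower_semi_B_Weyl R X);
       spectrum_of (@upper_semi_Fredholm R X); spectrum_of (@lower_semi_Fredholm R X);
       spectrum_of (@Fredholm R X); spectrum_of (@right_ess_Drazin R X);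
       spectrum_of (@bounded_below R X); spectrum_of (@surjective_op R X);
       spectrum_of (@upper_semi_Browder R X); spectrum_of (@lower_semi_Browder R X);
       spectrum_of (@Browder R X); spectrum_of (@right_Drazin R X);
       spectrum_of (@invertible_op R X)] sigma ->
  sigma T = boundary (sigma T) ->
  boundary (sigma T) = limit_point (sigma T) ->
  spectrum_of (@TUD R X) T = sigma T.
Proof.
move=> _ cT.
move=> [[[[[[[[[[[[[[]|]|]|]|]|]|]|]|]|]|]|]|]|] ->; apply: spectrum_TUD => //.
- by move=> S K bS [/(upper_semi_Fredholm_TUD bS)].
- exact: upper_semi_Weyl_dim.
- by move=> S K bS [/(lower_semi_Fredholm_TUD bS)].
- exact: lower_semi_Weyl_dim.
- by move=> S K bS [[/(upper_semi_Fredholm_TUD bS)]].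
- exact: Weyl_dim.
- exact: lower_semi_B_Weyl_TUD.
- exact: lower_semi_B_Weyl_dim.
- exact: upper_semi_Fredholm_TUD.
- exact: upper_semi_Fredholm_dim.
- exact: lower_semi_Fredholm_TUD.
- exact: lower_semi_Fredholm_dim.
- by move=> S K bS [/(upper_semi_Fredholm_TUD bS)].
- exact: Fredholm_dim.
- exact: right_ess_Drazin_TUD.
- exact: right_ess_Drazin_dim.
- exact: bounded_below_TUD.
- exact: bounded_below_dim.
- exact: surjective_TUD.
- exact: surjective_dim.
- by move=> S K bS [/(upper_semi_Fredholm_TUD bS)].
- exact: upper_semi_Browder_dim.
- by move=> S K bS [/(lower_semi_Fredholm_TUD bS)].
- exact: lower_semi_Browder_dim.
- by move=> S K bS [[/(upper_semi_Fredholm_TUD bS)]].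
- exact: Browder_dim.
- exact: right_Drazin_TUD.
- exact: right_Drazin_dim.
- by move=> S K bS /invertible_surjective/(surjective_TUD bS).
- exact: invertible_dim.
Qed.
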